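(* For any valid pair $(\mu,\nu)$ of velocity and delay distributions, almost surely $\hat v(\mu,\nu)=v_c(\mu,\nu)$.
   Context: Bullet process. Let $\mu$ (velocity distribution) and $\nu$ (delay distribution) be probability measures on $(0,\infty)$, and let $(v_i,\Delta_i)_{i\ge 0}$ be i.i.d. with law $\mu\otimes\nu$. Bullet $b_i=(i,v_i,\Delta_i)$ has index $i$, velocity $v_i$ and delay $\Delta_i$. Given bullets $(b_i)_{i\in J}$ indexed by a finite or infinite set $J=\{m,m+1,\dots\}$ of consecutive nonnegative integers, the bullet process on them is defined as follows: $b_i$ is fired from the origin at time $t_i=\sum_{m<j\le i}\Delta_j$ (so the first bullet is fired at time $0$) and its trajectory is $d_t(i)=v_i(t-t_i)$ for $t\ge t_i$. It becomes active at time $t_i$ and remains active until the first time, if ever, it collides with (is at the same position as) another active bullet; colliding bullets annihilate and are inactive at all later times. A bullet perishes in the process if it is annihilated, and otherwise survives in it. The pair $(\mu,\nu)$ is valid if almost surely no three bullets collide simultaneously. This is assumed throughout. Let $b_0^v=(0,v,\Delta_0)$ for $v\ge 0$ (velocity $0$ is allowed here), and let $\theta(v)$ be the probability that $b_0^v$ survives in the process on $(b_0^v,b_1,b_2,\dots)$. The critical velocity is $v_c=v_c(\mu,\nu)=\inf\{v\ge 0:\theta(v)>0\}\in[0,\infty]$ (with $\inf\varnothing=\infty$). Bullet $b_n$ is a potential survivor if it survives in the process on $(b_0,\dots,b_n)$. Almost surely there are infinitely many potential survivors; listing them by increasing index as $b_{j_0},b_{j_1},\dots$, define the random variable $\hat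 v=\hat v(\mu,\nu)=\limsup_{n\to\infty}v_{j_n}$. *)

(* Defs.v *)
From HB Require Import structures.
From mathcomp Require Import all_boot all_order all_algebra.
From mathcomp Require Import all_classical all_reals all_analysis.

Set Implicit Arguments.
Unset Strict Implicit.
Unset Printing Implicit Defensive.

Import Order.TTheory GRing.Theory Num.Theory.
Local Open Scope classical_set_scope.
Local Open Scope ring_scope.

Section deterministic_dynamics.
Context {R : realType}.

(* A sequence [b] of bullets is given by [b i = (v_i, Delta_i)].  An index set
   [J] is of the form {m, ..., n} or {m, m + 1, ...}; its least element [m] is
   passed separately because firing times are counted from it. *)
Implicit Types (b : nat -> R * R) (J : set nat) (m i j k n : nat) (t v : R).

Definition fire_time b m i : R := \sum_(m.+1 <= j < i.+1) (b j).2.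

Definition position b m i t : R := (b i).1 * (t - fire_time b m i).

(* [e i] is the time at which bullet [i] stops being active (+oo if never).
   The inequalities are not strict: a bullet takes part in the collision that
   annihilates it. *)
Definition collide b m J (e : nat -> \bar R) i j t : Prop :=
  [/\ [/\ J i, J j & i <> j],
      fire_time b m i <= t /\ (t%:E <= e i)%E,
      fire_time b m j <= t /\ (t%:E <= e j)%E
    & position b m i t = position b m j t].

(* [e] describes the bullet process on [(b_i)_(i in J)]: a bullet stops being
   active at its first collision with another active bullet, and only then.
   If finitely many bullets are fired before any given time, exactly one [e]
   (up to its values outside [J]) satisfies the last two clauses.  For an
   infinite [J] and i.i.d. positive delays this holds almost surely; if it
   fails there is no process. *)
Definition bullet_process b m J (e : nat -> \bar R) : Prop :=
  [/\ forall t, finite_set [set i | J i /\ fire_time b m i <= t],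
      forall i j t, collide b m J e i j t -> e i = t%:E
    & forall i, J i -> e i = +oo%E \/ exists j t, collide b m J e i j t].

Definition survives b m J i : Prop :=
  exists2 e, bullet_process b m J e & e i = +oo%E.

Definition triple_collision b m J (e : nat -> \bar R) : Prop :=
  exists i j k t,
    [/\ collide b m J e i j t, collide b m J e j k t & collide b m J e i k t].

Definition set_first_velocity v b : nat -> R * R :=
  fun i => if i == 0%N then (v, (b 0%N).2) else b i.

Definition potential_survivor b n : Prop :=
  survives b 0 [set i | (i <= n)%N] n.

(* [nth_potential_survivor b k] is j_k, the potential survivor preceded by
   exactly [k] others; the default value 0 is used only if there are at most
   [k] potential survivors, which has probability zero. *)
Definition nth_potential_survivor b k : nat :=
  xget 0%N [set n | potential_survivor b n /\
                    (\sum_(i < n) `[< potential_survivor b i >])%N = k].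

Definition vhat b : \bar R :=
  limn_esup (fun k => ((b (nth_potential_survivor b k)).1)%:E).

End deterministic_dynamics.

Section random_bullets.
Context {R : realType} {d : measure_display} {T : measurableType d}.
Variable P : probability T R.

Definition mutually_independent {d'} {T' : measurableType d'}
    (X : nat -> {RV P >-> T'}) : Prop :=
  forall (s : seq nat) (A : nat -> set T'),
    uniq s -> (forall i, measurable (A i)) ->
    P (\bigcap_(i in [set` s]) (X i @^-1` A i)) =
    (\prod_(i <- s) P (X i @^-1` A i))%E.

Variable X : nat -> {RV P >-> (measurableTypeR R * measurableTypeR R)%type}.

Definition iid_bullets (mu nu : probability (measurableTypeR R) R) : Prop :=
  mutually_independent X /\
  forall i A, measurable A -> distribution P (X i) A = (mu \x nu)%E A.

Definition valid : Prop :=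
  \forall w \ae P, forall e,
    bullet_process (X^~ w) 0 setT e -> ~ triple_collision (X^~ w) 0 setT e.

Definition theta (v : R) : \bar R :=
  P [set w | survives (set_first_velocity v (X^~ w)) 0 setT 0].

Definition critical_velocity : \bar R :=
  ereal_inf [set v%:E | v in [set v : R | 0 <= v /\ (0 < theta v)%E]].

End random_bullets.

(* Main.v *)
Require Import Defs.
From HB Require Import structures.
From mathcomp Require Import all_boot all_order all_algebra.
From mathcomp Require Import all_classical all_reals all_analysis.
From mathcomp Require Import ring lra.

Set Implicit Arguments.
Unset Strict Implicit.
Unset Printing Implicit Defensive.

Import Order.TTheory GRing.Theory Num.Theory.
Import measurable_realfun numFieldNormedType.Exports.
Local Open Scope classical_set_scope.
Local Open Scope ring_scope.

(** Call a bullet of velocity u placed in front of an independent bullet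
    sequence a ghost: [theta] at u is the probability that the ghost survives,
    i.e. that in the process of the bullets behind it no bullet reaches its
    line before dying.  Write A_n(u) for the event that b_n is a potential
    survivor with velocity greater than u.

    Upper bound.  Suppose that theta(u) > 0.  Let B_n(u) be the event that the
    ghost of velocity u fired together with b_n survives against b_(n+1),
    b_(n+2), ....  If A_n(u) and B_n(u) hold then the process on all bullets
    splits at b_n: nothing that comes after b_n ever gets past the ghost.  A later
    k with A_k(u) and B_k(u) would give a bullet b_k that survives for ever
    and, being faster than u, does get past it.  So at most one n satisfies
    A_n(u) and B_n(u) ([ghost_survives_unique]).  These two events depend on
    disjoint blocks of bullets and B_n(u) has probability theta(u), hence
    theta(u) * sum_n P(A_n(u)) <= 1, and by the Borel-Cantelli lemma only
    finitely many A_n(u) occur ([ae_finitely_many_faster0]).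

    Lower bound.  Suppose that theta(u) = 0, so that almost surely every ghost
    of velocity u, fired at whatever index, perishes.  Then A_n(u) occurs
    infinitely often, and this is a statement about a single realisation
    ([last_survives_infinitely_often]).  Survivors of the whole process are
    faster than u, since otherwise the ghost fired along with such a survivor
    would survive too; they are potential survivors, so if A_n(u) occurred
    finitely often there would be a last survivor b_l (or none).  Take a late
    time T and the first bullet b_m behind b_l that is alive at T.  The bullets
    from b_m on form a process of their own, and the ghost placed in front of
    them perishes.  The first of them that touches the line of the ghost is
    faster than u and at that time has nothing but the survivors in front of
    it, so it is a potential survivor as soon as it is not faster than b_l.
    Bullets faster than b_l are dealt with by the upper bound applied to the
    bullets behind b_l and to the velocity of b_l itself.

    The velocity of b_l is random, whereas the two bounds hold almost surely
    for one velocity at a time; by monotonicity it is enough to have them at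
    all rational velocities and at the critical velocity ([vhat_eq]).  Applied
    with u = 0, whose ghost is hit by the very next bullet, the lower bound
    also yields that there are infinitely many potential survivors.

    The probabilities above only make sense for measurable events.  A process
    with finitely many bullets is determined by guessing the partner of each
    bullet and checking finitely many inequalities between meeting times, and
    an infinite process agrees up to any given time with that of a long enough
    initial segment ([survives_setTE]). *)

(** * Annihilation driven by meeting times *)

Lemma ex_minimal_lt d (V : orderType d) (P : nat -> Prop) (g : nat -> V) (N : nat) :
  (exists i, P i) -> (forall i, P i -> (i < N)%N) ->
  exists2 i, P i & forall j, P j -> (g i <= g j)%O.
Proof.
move=> [i Pi] PN; pose i0 : 'I_N := Ordinal (PN i Pi).
have Pi0 : `[< P i0 >] by apply/asboolP.
case: (@arg_minP _ _ _ i0 (fun k : 'I_N => `[< P k >]) (fun k : 'I_N => g k) Pi0).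
move=> k /asboolP Pk kmin; exists k => // j Pj.
by apply: (kmin (Ordinal (PN j Pj))); apply/asboolP.
Qed.

Section annihilation.
Context {R : realType}.
Variables (M : nat -> nat -> \bar R) (f : nat -> R).
Hypothesis M_sym : forall i j, M i j = M j i.
Hypothesis f_le_M : forall i j, ((f i)%:E <= M i j)%E.

(** The rule of the process in terms of the first time [M i j] at which the
    bullets [i] and [j] meet, a single number per pair: this is what makes the
    process computable from finitely many comparisons when [J] is finite. *)
Definition annihilation (J : set nat) (e : nat -> \bar R) : Prop :=
  (forall i j, J i -> J j -> i <> j -> (M i j < +oo)%E ->
     (M i j <= e i)%E -> (M i j <= e j)%E -> e i = M i j) /\
  (forall i, J i -> e i = +oo%E \/
     exists j, [/\ J j, i <> j, (M i j < +oo)%E, (M i j <= e i)%E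
                 & (M i j <= e j)%E]).

Lemma annihilation_partner J e i : annihilation J e -> J i -> e i <> +oo%E ->
  exists j, [/\ J j, i <> j, M i j = e i & e j = e i].
Proof.
move=> [c1 c2] Ji /eqP ei; case: (c2 i Ji) => [/eqP|[j [Jj ij Mfin Mi Mj]]].
  by rewrite (negbTE ei).
exists j; split=> //; first by rewrite -(c1 i j).
rewrite (c1 i j)//; rewrite M_sym in Mfin Mi Mj *.
by apply: c1 => // /esym.
Qed.

Lemma annihilation_fire J e i : annihilation J e -> J i -> ((f i)%:E <= e i)%E.
Proof.
move=> ann Ji; case: (pselect (e i = +oo%E)) => [->|ei]; first exact: leey.
by have [j [_ _ <- _]] := annihilation_partner ann Ji ei.
Qed.

(** At its end [e k], the bullet [k] meets a partner that ends at the same time.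
    If [e'] kept both of them active up to that time, it would have to end [k]
    there as well. *)
Lemma annihilation_first_disagreement J J' e e' (t : R) k :
  (forall i, f i <= t -> J i -> J' i) ->
  annihilation J e -> annihilation J' e' -> J k -> (e k <= t%:E)%E ->
  (forall j, J j -> e j = e k -> (e k <= e' j)%E) -> (e' k <= e k)%E.
Proof.
move=> JJ' ann ann' Jk ekt ek_le; rewrite leNgt; apply/negP => lt_e.
have ekfin : e k <> +oo%E by move=> h; move: lt_e; rewrite h ltNge leey.
have [j [Jj kj Mkj ej]] := annihilation_partner ann Jk ekfin.
have ft i : J i -> e i = e k -> f i <= t.
  move=> Ji ei; rewrite -lee_fin (le_trans _ ekt)// -ei.
  by rewrite (annihilation_fire ann).
have : e' k = M k j.
  apply: ann'.1 => //; rewrite ?Mkj; [exact/JJ'/Jk/ft|exact/JJ'/Jj/ft| | |].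
  - by rewrite ltey; exact/eqP.
  - exact: ltW.
  - exact: ek_le.
by move: lt_e; rewrite Mkj => /[swap] ->; rewrite ltxx.
Qed.

(** Consider the earliest time, up to [t], at which the two processes differ:
    the previous lemma applies to a bullet that ends at that time in one of
    them.  Bullets fired after [t] have no influence, so the index sets only
    need to agree on the bullets fired by time [t]. *)
Lemma annihilation_agree J J' e e' (t : R) :
  (exists N, forall i, J i -> f i <= t -> (i < N)%N) ->
  (forall i, f i <= t -> J i <-> J' i) ->
  annihilation J e -> annihilation J' e' ->
  forall i, J i -> J' i -> (e i <= t%:E)%E \/ (e' i <= t%:E)%E -> e i = e' i.
Proof.
move=> [N JN] JJ' ann ann' i Ji J'i eit; apply: contrapT => neq.
pose P i := [/\ J i, J' i, (Order.min (e i) (e' i) <= t%:E)%E & e i <> e' i].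
have [||k [Jk J'k kt kneq] kmin] :=
    @ex_minimal_lt _ _ P (fun k => Order.min (e k) (e' k)) N.
- by exists i; split=> //; rewrite ge_min; case: eit => ->; rewrite ?orbT.
- move=> k [Jk J'k kt _]; apply: JN => //; rewrite -lee_fin (le_trans _ kt)//.
  by rewrite le_min (annihilation_fire ann)// (annihilation_fire ann').
apply: kneq; apply/eqP; rewrite eq_le; apply/andP.
have minle j : J j -> J' j -> e j <> e' j ->
    (Order.min (e k) (e' k) <= e j)%E /\ (Order.min (e k) (e' k) <= e' j)%E.
  move=> Jj J'j neqj; case: (leP (Order.min (e j) (e' j)) t%:E) => jt.
    have /kmin : P j by [].
    by rewrite le_min => /andP[].
  by move: (ltW (le_lt_trans kt jt)); rewrite le_min => /andP[].
have fe1 j : J j -> (e j <= t%:E)%E -> J' j.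
  move=> Jj jt; apply/JJ' => //; rewrite -lee_fin (le_trans _ jt)//.
  by rewrite (annihilation_fire ann).
have fe2 j : J' j -> (e' j <= t%:E)%E -> J j.
  move=> Jj jt; apply/JJ' => //; rewrite -lee_fin (le_trans _ jt)//.
  by rewrite (annihilation_fire ann').
case/orP: (le_total (e k) (e' k)) => le_e; split=> //.
  have ekt : (e k <= t%:E)%E by move: kt; rewrite minElt; case: ltgtP le_e => // ->.
  apply: (annihilation_first_disagreement _ ann ann' Jk ekt) => [j ?|j Jj ej].
    by move/JJ'; exact.
  have J'j : J' j by apply: fe1; rewrite ?ej.
  case: (pselect (e j = e' j)) => [<-|jneq]; first by rewrite ej.
  by have [_] := minle j Jj J'j jneq; rewrite minElt; case: ltgtP le_e => // ->.
have ekt : (e' k <= t%:E)%E by move: kt; rewrite minElt; case: ltgtP le_e => // ->.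
apply: (annihilation_first_disagreement _ ann' ann J'k ekt) => [j ?|j J'j ej].
  by move/JJ'; exact.
have Jj : J j by apply: fe2; rewrite ?ej.
case: (pselect (e j = e' j)) => [->|jneq]; first by rewrite ej.
by have [] := minle j Jj J'j jneq; rewrite minElt; case: ltgtP le_e => // ->.
Qed.

Lemma annihilation_unique J e e' :
  (forall t, exists N, forall i, J i -> f i <= t -> (i < N)%N) ->
  annihilation J e -> annihilation J e' -> forall i, J i -> e i = e' i.
Proof.
move=> lf ann ann' i Ji.
have agree (t : R) := @annihilation_agree J J e e' t (lf t)
   (fun _ _ => iff_refl _) ann ann' i Ji Ji.
have := annihilation_fire ann Ji; have := annihilation_fire ann' Ji.
case E : (e i) => [r| |]//; case E' : (e' i) => [r'| |]// _ _; rewrite -E -E'.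
- by apply: (agree r); rewrite E; left.
- by apply: (agree r); rewrite E; left.
- by apply: (agree r'); rewrite E'; right.
Qed.

(** Induction on the number of bullets: those involved in a meeting at the
    earliest meeting time annihilate, and they meet nobody earlier, so that
    they can be removed. *)
Lemma annihilation_exists_fin (s : seq nat) :
  exists e, annihilation [set i | i \in s] e.
Proof.
have [n] := ubnP (size s); elim: n => // n IH in s *; rewrite ltnS => sn.
pose P i := i \in s /\ exists j, [/\ j \in s, i <> j & (M i j < +oo)%E].
case: (pselect (exists i, P i)) => [[i0 Pi0]|noP]; last first.
  exists (fun=> +oo%E); split=> [i j /= si sj ij Mij|i si]; last by left.
  by exfalso; apply: noP; exists i; split=> //; exists j.
pose sM := [seq M p.1 p.2 | p <- [seq (i, j) | i <- s, j <- s] & p.1 != p.2].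
pose mu := \big[Order.min/+oo%E]_(x <- sM) x.
have muP : forall i j, i \in s -> j \in s -> i <> j -> (mu <= M i j)%E.
  move=> i j si sj /eqP ij; rewrite /mu; apply: ge_bigmin_seq => //.
  by apply/mapP; exists (i, j) => //; rewrite mem_filter/= ij allpairs_f.
have [i1 [j1 [si1 sj1 ij1 M1 M1y]]] :
    exists i j, [/\ i \in s, j \in s, i <> j, M i j = mu & (mu < +oo)%E].
  case: Pi0 => si0 [j0 [sj0 ij0 M0]].
  have muy : (mu < +oo)%E by exact: le_lt_trans (muP _ _ si0 sj0 ij0) M0.
  have : mu \in +oo%E :: sM.
    rewrite /mu; move: (sM) => l; elim: l => [|x l]; first by rewrite big_nil inE.
    rewrite big_cons minElt; case: ifP => _; first by rewrite !inE eqxx orbT.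
    by rewrite !inE => /orP[->//|->]; rewrite !orbT.
  rewrite inE => /orP[/eqP mueq|]; first by move: muy; rewrite mueq ltxx.
  move=> /mapP[[i j]]; rewrite mem_filter/= => /andP[ij] /allpairsP[[i' j']]/=.
  by move=> [si' sj' [ii jj]] mue; exists i, j; rewrite ii jj in ij mue *;
     split=> //; apply/eqP.
pose D i := has (fun j => (i != j) && (M i j == mu)) s.
pose s' := [seq i <- s | ~~ D i].
have DP i j : j \in s -> i <> j -> M i j = mu -> D i.
  by move=> sj /eqP ij Mij; apply/hasP; exists j; rewrite // ij Mij eqxx.
have [|e' [c1 c2]] := IH s'.
  apply: leq_trans sn; rewrite size_filter -(count_predC D s) -addn1 addnC leq_add2r.
  by rewrite -has_count; apply/hasP; exists i1 => //; apply: (DP _ j1).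
have s'E i : (i \in s') = ~~ D i && (i \in s) by rewrite mem_filter.
exists (fun i => if D i then mu else e' i); split=> [i j /= si sj ij Mij|i /= si].
- have muij := muP _ _ si sj ij.
  case: ifPn => [Di|nDi].
    by move=> Mi _; apply/eqP; rewrite eq_le muij Mi.
  case: ifPn => [Dj|nDj].
    move=> _ Mj; exfalso; move/negP: nDi; apply; apply: (DP _ j) => //.
    by apply/eqP; rewrite eq_le muij Mj.
  by apply: c1 => //=; rewrite s'E ?nDi ?nDj.
- case: ifPn => [/hasP[j sj /andP[/eqP ij /eqP Mij]]|nDi].
    right; exists j; split=> //; rewrite ?Mij//.
    have -> : D j by apply: (DP _ i) => //; [exact: nesym|rewrite M_sym].
    by [].
  case: (c2 i); [by rewrite /= s'E nDi|by left|move=> [j [/= sj ij Mij Mi Mj]]].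
  move: sj; rewrite s'E => /andP[nDj sj].
  by right; exists j; rewrite (negbTE nDj); split.
Qed.

(** The processes of the bullets fired by the times 0, 1, 2, ... agree more and
    more by [annihilation_agree]; the end of a bullet is the value on which
    they stabilise. *)
Lemma annihilation_exists (J : set nat) :
  (forall t, exists N, forall i, J i -> f i <= t -> (i < N)%N) ->
  exists e, annihilation J e.
Proof.
move=> lf.
have /choice[E Eann] : forall n : nat, exists e,
    annihilation [set i | J i /\ f i <= n%:R] e.
  move=> n; have [N JN] := lf n%:R.
  have [e ann] := annihilation_exists_fin
    [seq i <- iota 0 N | `[< J i /\ f i <= n%:R >]].
  exists e; rewrite (_ : [set i | _] = [set i | i \in
    [seq i <- iota 0 N | `[< J i /\ f i <= n%:R >]]])//.
  apply/seteqP; split=> i /=; rewrite mem_filter mem_iota.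
    by move=> Pi; apply/andP; split; [exact/asboolP|apply: JN; case: Pi].
  by move=> /andP[/asboolP].
have agree n m i : (n <= m)%N -> J i -> f i <= n%:R ->
    (E n i <= n%:R%:E)%E \/ (E m i <= n%:R%:E)%E -> E n i = E m i.
  move=> nm Ji fi; have [N JN] := lf n%:R.
  apply: (annihilation_agree _ _ (Eann n) (Eann m)) => //=.
  - by exists N => k [Jk fk _]; exact: JN.
  - by move=> k fk; split=> -[Jk _]; split=> //; rewrite (le_trans fk)// ler_nat.
  - by split=> //; rewrite (le_trans fi)// ler_nat.
pose Q i n := f i <= n%:R /\ (E n i <= n%:R%:E)%E.
pose e i := if pselect (exists n, Q i n) is left h then E (sval (cid h)) i else +oo%E.
have eP i n : J i -> f i <= n%:R ->
    (e i = E n i) \/ ((n%:R%:E < e i)%E /\ (n%:R%:E < E n i)%E).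
  move=> Ji fi; rewrite /e; case: pselect => [h|nh].
    case: (cid h) => m [fm Em] /=.
    have [mn|nm] := leqP m n; first by left; apply: agree => //; left.
    case: (leP (E n i) n%:R%:E) => En.
      by left; apply/esym/agree => //; [exact: ltnW|left].
    case: (leP (E m i) n%:R%:E) => Em'; last by right.
    by left; apply/esym/agree => //; [exact: ltnW|right].
  case: (leP (E n i) n%:R%:E) => En; first by exfalso; apply: nh; exists n.
  by right; rewrite ltry.
have ebnd (r : R) : exists n : nat, r <= n%:R.
  by exists (Num.bound `|r|); rewrite (le_trans (ler_norm _))// ltW// archi_boundP.
exists e; split=> [i j Ji Jj ij|i Ji].
- have := f_le_M i j; move Mij: (M i j) => m.
  case: m Mij => [r| |] Mij fm; rewrite ?ltxx// => _ ri rj.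
  have [n rn] := ebnd r.
  have fi : f i <= n%:R by rewrite (le_trans _ rn)// -lee_fin -Mij.
  have fj : f j <= n%:R by rewrite (le_trans _ rn)// -lee_fin -Mij M_sym.
  have rle k : J k -> f k <= n%:R -> (r%:E <= e k)%E -> (r%:E <= E n k)%E.
    move=> Jk fk; case: (eP k n Jk fk) => [->//|[_ h] _].
    by rewrite (le_trans _ (ltW h))// lee_fin.
  have Ei : E n i = r%:E.
    by rewrite -Mij; apply: (Eann n).1; rewrite ?Mij ?ltry//; exact: rle.
  by case: (eP i n Ji fi) => [->//|[_]]; rewrite Ei lte_fin ltNge rn.
- case: (pselect (e i = +oo%E)) => [|ei]; [by left|right].
  have [n [fi En]] : exists n, Q i n.
    by move: ei; rewrite /e; case: pselect.
  have eE : e i = E n i.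
    case: (eP i n Ji fi) => [//|[_ h]].
    by move: En; rewrite leNgt h.
  rewrite eE in ei *.
  have [j [[Jj fj] ij Mij ej]] := annihilation_partner (Eann n) (conj Ji fi) ei.
  have ejE : e j = E n j.
    case: (eP j n Jj fj) => [//|[_ h]].
    by move: En; rewrite -ej leNgt h.
  by exists j; rewrite Mij ejE ej; split=> //; rewrite ltey; exact/eqP.
Qed.

End annihilation.

(** * Meeting times of bullets *)

Lemma finite_set_natP (A : set nat) :
  finite_set A <-> exists N, forall i, A i -> (i < N)%N.
Proof.
split=> [/finite_fsetP[X ->]|[N AN]].
  exists (\max_(i <- finmap.enum_fset X) i).+1 => i /= iX; rewrite ltnS.
  exact: (leq_bigmax_seq (F := id)).
by apply: (@sub_finite_set _ _ `I_N) => // i /AN.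
Qed.

Section meeting.
Context {R : realType}.
Implicit Types (f v : nat -> R) (J : set nat) (e : nat -> \bar R).

Definition meets f v i j (t : R) : Prop :=
  [/\ f i <= t, f j <= t & v i * (t - f i) = v j * (t - f j)].

(** The two trajectories are affine, so their meetings form an empty set, a
    singleton, or, for coinciding trajectories, a half-line; all these cases
    are kept because measurability of survival is needed on every sequence,
    including those with negative delays or velocities. *)
Definition meeting_time f v i j : \bar R :=
  let num := v i * f i - v j * f j in
  let t := if v i == v j then Num.max (f i) (f j) else num / (v i - v j) in
  if ((v i == v j) ==> (num == 0)) && (Num.max (f i) (f j) <= t)
  then t%:E else +oo%E.

Lemma meeting_time_meets f v i j t :
  meeting_time f v i j = t%:E -> meets f v i j t.
Proof.
rewrite /meeting_time; case: ifP => // /andP[h]; rewrite ge_max => /andP[fi fj].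
move=> [<-]; split=> //; case: eqVneq h {fi fj} => [->/=|vij _] //.
  rewrite -mulrBr mulf_eq0 => /orP[/eqP->|]; first by rewrite !mul0r.
  by rewrite subr_eq0 => /eqP->.
by field; rewrite subr_eq0.
Qed.

Lemma meets_meeting_time f v i j t :
  meets f v i j t -> (meeting_time f v i j <= t%:E)%E.
Proof.
move=> [fi fj E]; rewrite /meeting_time.
have fm : Num.max (f i) (f j) <= t by rewrite ge_max fi.
case: eqVneq => [vij|vij] /=.
  rewrite lexx andbT; case: ifPn => [_|/eqP[]]; first by rewrite lee_fin.
  by move: E; rewrite vij !mulrBr => /addrI /oppr_inj ->; rewrite subrr.
have vij0 : v i - v j != 0 by rewrite subr_eq0.
have -> : (v i * f i - v j * f j) / (v i - v j) = t.
  apply: (mulIf vij0); rewrite divfK//.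
  by apply/eqP; rewrite -subr_eq0; apply/eqP; move: E; lra.
by rewrite fm.
Qed.

Lemma meets_sym f v i j t : meets f v i j t -> meets f v j i t.
Proof. by case. Qed.

Lemma meeting_time_sym f v i j : meeting_time f v i j = meeting_time f v j i.
Proof.
apply/eqP; rewrite eq_le; apply/andP.
have h k l : (meeting_time f v k l <= meeting_time f v l k)%E.
  case E : (meeting_time f v l k) => [r| |]; last 2 first.
  - by rewrite leey.
  - by move: E; rewrite /meeting_time; case: ifP.
  by rewrite meets_meeting_time//; exact/meets_sym/meeting_time_meets.
by split.
Qed.

Lemma fire_le_meeting_time f v i j : ((f i)%:E <= meeting_time f v i j)%E.
Proof.
case E : (meeting_time f v i j) => [r| |]; last 2 first.
- by rewrite leey.
- by move: E; rewrite /meeting_time; case: ifP.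
by rewrite lee_fin; have [] := meeting_time_meets E.
Qed.

Lemma meeting_time_fin f v i j : (meeting_time f v i j < +oo)%E ->
  exists2 t, meeting_time f v i j = t%:E & meets f v i j t.
Proof.
have := fire_le_meeting_time f v i j.
case E : (meeting_time f v i j) => [t| |]; rewrite ?ltxx// => _ _.
by exists t => //; exact: meeting_time_meets.
Qed.

(** An equivalent form of the last two clauses of [bullet_process], with firing
    times and velocities given separately: the origin of time and the numbering
    of the bullets are left free. *)
Definition process f v J e : Prop :=
  (forall i j t, J i -> J j -> i <> j -> meets f v i j t ->
     (t%:E <= e i)%E -> (t%:E <= e j)%E -> e i = t%:E) /\
  (forall i, J i -> e i = +oo%E \/
     exists j t, [/\ J j, i <> j, meets f v i j t, e i = t%:E & e j = t%:E]).

Lemma process_annihilation f v J e :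
  process f v J e <-> annihilation (meeting_time f v) J e.
Proof.
split=> [[c1 c2]|ann].
  split=> [i j Ji Jj ij /meeting_time_fin[t -> mt]|i Ji]; first exact: c1.
  case: (c2 i Ji) => [->|[j [t [Jj ij mt ei ej]]]]; [by left|right].
  have Mt := meets_meeting_time mt.
  by exists j; rewrite ei ej (le_lt_trans Mt)// ltry.
split=> [i j t Ji Jj ij mt ti tj|i Ji].
  have Mt := meets_meeting_time mt.
  have eM : e i = meeting_time f v i j.
    apply: ann.1 => //; [exact: le_lt_trans (ltry t)|exact: le_trans ti|].
    exact: le_trans tj.
  by apply/eqP; rewrite eq_le ti eM Mt.
case: (pselect (e i = +oo%E)) => [|ei]; [by left|right].
have [j [Jj ij Mij ej]] := annihilation_partner (@meeting_time_sym f v) ann Ji ei.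
have [|t Mt mt] := @meeting_time_fin f v i j.
  by rewrite Mij ltey; exact/eqP.
by exists j, t; split=> //; rewrite ?ej -Mij.
Qed.

Definition locally_finite f J : Prop :=
  forall t, exists N, forall i, J i -> f i <= t -> (i < N)%N.

Lemma process_unique f v J e e' : locally_finite f J ->
  process f v J e -> process f v J e' -> forall i, J i -> e i = e' i.
Proof.
move=> lf /process_annihilation ann /process_annihilation ann'.
exact: (annihilation_unique (@meeting_time_sym f v) (@fire_le_meeting_time f v)).
Qed.

Lemma process_exists f v J : locally_finite f J -> exists e, process f v J e.
Proof.
move=> lf; have [|e /process_annihilation] := annihilation_exists
  (@meeting_time_sym f v) (@fire_le_meeting_time f v) (J := J); last by exists e.
exact: lf.
Qed.

Lemma process_agree f v J J' e e' (t : R) :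
  (exists N, forall i, J i -> f i <= t -> (i < N)%N) ->
  (forall i, f i <= t -> J i <-> J' i) ->
  process f v J e -> process f v J' e' ->
  forall i, J i -> J' i -> (e i <= t%:E)%E \/ (e' i <= t%:E)%E -> e i = e' i.
Proof.
move=> lf JJ' /process_annihilation ann /process_annihilation ann'.
exact: (annihilation_agree (@meeting_time_sym f v) (@fire_le_meeting_time f v)
  lf JJ' ann ann').
Qed.

Lemma bullet_processE (b : nat -> R * R) m J e :
  bullet_process b m J e <->
  locally_finite (fire_time b m) J /\
  process (fire_time b m) (fun i => (b i).1) J e.
Proof.
split=> [[lf c1 c2]|[lf [c1 c2]]].
  split=> [t|].
    have /finite_set_natP[N JN] := lf t.
    by exists N => i Ji fi; exact: JN.
  split=> [i j t Ji Jj ij [fi fj pos] ti tj|i Ji]; first exact: (c1 i j t).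
  case: (c2 i Ji) => [|[j [t col]]]; [by left|right; exists j, t].
  have ei := c1 _ _ _ col; case: col => -[_ Jj ij] [fi ti] [fj tj] pos.
  split=> //; apply: (c1 j i t).
  by split=> //; split=> //; exact: nesym.
split=> [t|i j t [[Ji Jj ij] [fi ti] [fj tj] pos]|i Ji].
- by apply/finite_set_natP; have [N JN] := lf t; exists N => i []; exact: JN.
- exact: (c1 i j t).
- case: (c2 i Ji) => [->|[j [t [Jj ij [fi fj pos] ei ej]]]]; [by left|right].
  by exists j, t; split=> //; rewrite ?ei ?ej.
Qed.

Lemma survivesE (b : nat -> R * R) m J i :
  survives b m J i <-> locally_finite (fire_time b m) J /\
    exists2 e, process (fire_time b m) (fun i => (b i).1) J e & e i = +oo%E.
Proof.
split=> [[e /bullet_processE[lf pe] ei]|[lf [e pe ei]]]; first by split=> //; exists e.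
by exists e => //; apply/bullet_processE.
Qed.

End meeting.

(** * Shielding and ghost lines *)

Lemma affine_crossing (R : realFieldType) (p g q h s t : R) : s <= t ->
  q * (s - h) <= p * (s - g) -> p * (t - g) <= q * (t - h) ->
  exists r, [/\ s <= r, r <= t & p * (r - g) = q * (r - h)].
Proof.
move=> st; rewrite -(subr_ge0 (q * (s - h))) -(subr_ge0 (p * (t - g))).
set a := _ - _; set b := _ - _ => a0 b0.
have [ab0|ab0] := eqVneq (a + b) 0.
  exists s; split=> //; apply/eqP; rewrite -subr_eq0 -/a.
  by rewrite eq_le a0 andbT -ab0 lerDl.
have ab : 0 < a + b by rewrite lt0r ab0 addr_ge0.
exists (s + a / (a + b) * (t - s)); split.
- by rewrite lerDl mulr_ge0 ?subr_ge0// divr_ge0// ltW.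
- rewrite -lerBrDl -[leRHS]mul1r ler_wpM2r ?subr_ge0// ler_pdivrMr// mul1r.
  by rewrite lerDl.
- apply/eqP; rewrite -subr_eq0; apply/eqP.
  by rewrite /a /b in ab0 *; field.
Qed.

Section firing_order.
Context {R : realType}.
Variables (f v : nat -> R).
Hypothesis f_incr : forall i j, (i < j)%N -> f i < f j.
Hypothesis f_infty : forall t, exists N, forall i, (N <= i)%N -> t < f i.
Hypothesis v_gt0 : forall i, 0 < v i.

Lemma fire_locally_finite J : locally_finite f J.
Proof.
move=> t; have [N tN] := f_infty t; exists N => i _ fi; rewrite ltnNge.
by apply/negP => /tN; rewrite ltNge fi.
Qed.

Lemma fire_le i j : (i <= j)%N -> f i <= f j.
Proof. by rewrite leq_eqVlt => /orP[/eqP->//|/f_incr/ltW]. Qed.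

Lemma fire_lt_end J e i : process f v J e -> J i -> ((f i)%:E < e i)%E.
Proof.
move=> [c1 c2] Ji; case: (c2 i Ji) => [->|[j [t [Jj ij [fi fj pos] -> _]]]].
  exact: ltry.
rewrite lte_fin lt_neqAle fi andbT; apply/eqP => E.
move: pos; rewrite -E subrr mulr0 => /esym/eqP; rewrite mulf_eq0 gt_eqF//=.
rewrite subr_eq0 => /eqP E'; apply: ij.
case: (ltgtP i j) => // /f_incr; by rewrite E' ltxx.
Qed.

(** An earlier bullet starts ahead, and affine functions cannot change order
    without taking the same value. *)
Lemma ahead_until_meeting i j t : (i < j)%N -> f j <= t ->
  (forall s, meets f v i j s -> s <= t -> False) ->
  v j * (t - f j) < v i * (t - f i).
Proof.
move=> ij fjt nomeet; rewrite ltNge; apply/negP => le_pos.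
have fij := f_incr ij.
have [r [fr rt pos]] : exists r, [/\ f j <= r, r <= t &
    v i * (r - f i) = v j * (r - f j)].
  apply: affine_crossing => //.
  by rewrite subrr mulr0 mulr_ge0 ?subr_ge0 ?ltW.
by apply: (nomeet r) => //; split=> //; rewrite (le_trans (ltW fij)).
Qed.

Lemma process_collide J e i j t : process f v J e -> J i -> J j -> i <> j ->
  meets f v i j t -> (t%:E <= e i)%E -> (t%:E <= e j)%E ->
  e i = t%:E /\ e j = t%:E.
Proof.
move=> [c1 _] Ji Jj ij mt ti tj; split; first exact: (c1 i j).
by apply: (c1 j i) => //; [exact: nesym|exact: meets_sym].
Qed.

(** As long as a bullet is alive it stays strictly between the earlier and the
    later ones. *)
Lemma shield J e i n j t : process f v J e -> J i -> J n -> J j ->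
  (i < n)%N -> (n < j)%N -> meets f v i j t ->
  (t%:E <= e i)%E -> (t%:E < e n)%E -> (t%:E <= e j)%E -> False.
Proof.
move=> pe Ji Jn Jj lt_in lt_nj [fi fj pos] ti tn tj.
have fnt : f n <= t by rewrite (le_trans _ fj)// fire_le// ltnW.
have h k l : J k -> J l -> (k < l)%N -> (k = n \/ l = n) ->
    (t%:E <= e k)%E -> (t%:E <= e l)%E -> forall s, meets f v k l s -> s <= t -> False.
  move=> Jk Jl kl kln tk tl s ms st.
  have kl' : k <> l by move=> E; rewrite E ltnn in kl.
  have se : (s%:E <= t%:E)%E by rewrite lee_fin.
  have [ek el] := process_collide pe Jk Jl kl' ms (le_trans se tk) (le_trans se tl).
  by case: kln => E; subst; move: tn; rewrite ?ek ?el lte_fin ltNge st.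
have p1 : v n * (t - f n) < v i * (t - f i).
  by apply: ahead_until_meeting => //; apply: (h i n) => //; [right|exact: ltW].
have p2 : v j * (t - f j) < v n * (t - f n).
  by apply: ahead_until_meeting => //; apply: (h n j) => //; [left|exact: ltW].
by have := lt_trans p2 p1; rewrite pos ltxx.
Qed.

Lemma process_restrict J J' e : process f v J e -> J' `<=` J ->
  (forall i j t, J' i -> J j -> ~ J' j -> meets f v i j t ->
     (t%:E <= e i)%E -> (t%:E <= e j)%E -> False) ->
  process f v J' e.
Proof.
move=> [c1 c2] J'J iso; split=> [i j t J'i J'j|i J'i].
  by apply: c1; exact: J'J.
case: (c2 i (J'J _ J'i)) => [|[j [t [Jj ij mt ei ej]]]]; [by left|right].
exists j, t; split=> //; apply: contrapT => J'j.
by apply: (iso i j t) => //; rewrite ?ei ?ej.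
Qed.

(** [m] is the first real bullet and [g] the firing time of the ghost.  The
    ghost is not a member of the process: surviving means that no bullet
    touches its line while active. *)
Definition ghost_clear m u g : Prop := exists2 e, process f v [set i | (m <= i)%N] e &
  forall j t, (m <= j)%N -> f j <= t -> (t%:E <= e j)%E ->
    v j * (t - f j) <> u * (t - g).

(** For [a = 0] this says that [n] is a potential survivor. *)
Definition last_survives a n : Prop :=
  exists2 e, process f v [set i | (a <= i <= n)%N] e & e n = +oo%E.

Lemma behind_line e m u g : 0 <= u -> g < f m ->
  (forall j t, (m <= j)%N -> f j <= t -> (t%:E <= e j)%E ->
    v j * (t - f j) <> u * (t - g)) ->
  forall j t, (m <= j)%N -> f j <= t -> (t%:E <= e j)%E ->
    v j * (t - f j) < u * (t - g).
Proof.
move=> u0 gm nt j t mj fj tj; rewrite ltNge; apply/negP => le_pos.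
have [r [fr rt pos]] : exists r, [/\ f j <= r, r <= t &
    u * (r - g) = v j * (r - f j)].
  apply: affine_crossing => //.
  by rewrite subrr mulr0 mulr_ge0// subr_ge0 (le_trans (ltW gm))// fire_le.
apply: (nt j r) => //; apply: le_trans tj.
by rewrite lee_fin.
Qed.

(** A bullet that is never annihilated shields for ever. *)
Lemma survivor_isolates e l : process f v setT e -> e l = +oo%E ->
  forall i j t, (i <= l)%N -> (l < j)%N -> meets f v i j t ->
     (t%:E <= e i)%E -> (t%:E <= e j)%E -> False.
Proof.
move=> pe el i j t il lj mt ti tj; move: il; rewrite leq_eqVlt => /orP[/eqP il|il].
  subst i; have lj' : l <> j by move=> E; rewrite E ltnn in lj.
  have [] : e l = t%:E /\ e j = t%:E by exact: (process_collide pe).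
  by rewrite el.
by apply: (shield pe _ _ _ il lj mt) => //; rewrite el ltry.
Qed.

Lemma survivor_last_survives e l : process f v setT e -> e l = +oo%E -> last_survives 0 l.
Proof.
move=> pe el; exists e => //; apply: (process_restrict pe) => // i j t /= il _.
by move=> /negP; rewrite -ltnNge => lj; exact: (survivor_isolates pe el il lj).
Qed.

(** The bullets behind a survivor stay behind its line, a fortiori behind the
    line of a faster ghost fired together with it. *)
Lemma survivor_ghost_clear e l u : process f v setT e -> e l = +oo%E ->
  v l <= u -> ghost_clear l.+1 u (f l).
Proof.
move=> pe el vu; exists e => [|j t lj fj tj].
  apply: (process_restrict pe) => // j i t /= lj _ /negP.
  rewrite -leqNgt => il /meets_sym mt tj ti.
  exact: (survivor_isolates pe el il lj mt).
have : v j * (t - f j) < v l * (t - f l).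
  apply: ahead_until_meeting => // s ms st.
  apply: (survivor_isolates pe el (leqnn l) lj ms); first by rewrite el leey.
  by apply: le_trans tj; rewrite lee_fin.
move=> lt_pos E; move: lt_pos; rewrite E ltNge ler_wpM2r// subr_ge0.
by rewrite (le_trans _ fj)// fire_le// ltnW.
Qed.

(** Gluing: while active, the bullets up to [n] stay on or above the line of the
    ghost because [n] shields them, and the later ones stay below it because the
    ghost survives, so that the process on all bullets is the union of the two. *)
Lemma last_survives_ghost_clear n u : 0 <= u -> u <= v n ->
  last_survives 0 n -> ghost_clear n.+1 u (f n) ->
  exists2 e, process f v setT e & e n = +oo%E /\
    forall j t, (n < j)%N -> f j <= t -> (t%:E <= e j)%E ->
      v j * (t - f j) < u * (t - f n).
Proof.
move=> u0 un [e1 p1 e1n] [e3 p3 nt].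
have lt_line := behind_line u0 (f_incr (ltnSn n)) nt.
pose E i := if (i <= n)%N then e1 i else e3 i.
have cross i j t : (i <= n)%N -> (n < j)%N -> meets f v i j t ->
    (t%:E <= e1 i)%E -> (t%:E <= e3 j)%E -> False.
  move=> le_in nj [fi fj pos] ti tj.
  have lt_pos := lt_line j t nj fj tj.
  have fnt : f n <= t by rewrite (le_trans _ fj)// fire_le// ltnW.
  have : v n * (t - f n) <= v i * (t - f i).
    move: le_in; rewrite leq_eqVlt => /orP[/eqP->//|lt_in].
    apply/ltW/ahead_until_meeting => // s ms st.
    have in' : i <> n by move=> E'; rewrite E' ltnn in lt_in.
    have [] : e1 i = s%:E /\ e1 n = s%:E; last by rewrite e1n.
    apply: (process_collide p1) => //=; first by rewrite ltnW.
      by apply: le_trans ti; rewrite lee_fin.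
    by rewrite e1n leey.
  apply/negP; rewrite -ltNge pos (lt_le_trans lt_pos)//.
  by rewrite ler_wpM2r// subr_ge0.
exists E; last first.
  split=> [|j t nj fj tj]; first by rewrite /E leqnn.
  by apply: lt_line => //; move: tj; rewrite /E leqNgt nj.
split=> [i j t _ _ ij mt|i _].
  rewrite /E; case: leqP => le_in; case: leqP => le_jn.
  - exact: p1.1.
  - by move=> ti tj; exfalso; apply: (cross i j t).
  - by move=> ti tj; exfalso; apply: (cross j i t) => //; exact: meets_sym.
  - exact: p3.1.
rewrite /E; case: leqP => le_in.
  case: (p1.2 i le_in) => [|[j [t [/= jn ij mt ei ej]]]]; [by left|right].
  by exists j, t; rewrite jn; split.
case: (p3.2 i le_in) => [|[j [t [/= jn ij mt ei ej]]]]; [by left|right].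
by exists j, t; rewrite leqNgt jn; split.
Qed.

(** Both gluings produce the unique process on all bullets: in it [k] is never
    annihilated, so it reaches the slower line of the ghost fired with [n]. *)
Lemma ghost_clear_unique n k u : 0 <= u -> (n < k)%N ->
  u < v n -> last_survives 0 n -> ghost_clear n.+1 u (f n) ->
  u < v k -> last_survives 0 k -> ghost_clear k.+1 u (f k) -> False.
Proof.
move=> u0 nk un Fn Cn uk Fk Ck.
have [e pe [_ lt_line]] := last_survives_ghost_clear u0 (ltW un) Fn Cn.
have [e' pe' [e'k _]] := last_survives_ghost_clear u0 (ltW uk) Fk Ck.
have ek : e k = +oo%E.
  by rewrite -e'k; apply: (process_unique (@fire_locally_finite setT) pe pe').
have vuk : 0 < v k - u by rewrite subr_gt0.
pose t := f k + u * (f k - f n) / (v k - u).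
have fkn := f_incr nk.
have fkt : f k <= t.
  by rewrite /t lerDl mulr_ge0 ?mulr_ge0 ?subr_ge0 ?invr_ge0// ltW// subr_ge0.
have := lt_line k t nk fkt; rewrite ek leey => /(_ isT).
suff -> : v k * (t - f k) = u * (t - f n) by rewrite ltxx.
by rewrite /t; field; rewrite gt_eqF.
Qed.

End firing_order.

(** * A perishing ghost leaves infinitely many faster potential survivors *)

Section front_runner.
Context {R : realType}.
Variables (f v : nat -> R).
Hypothesis f_incr : forall i j, (i < j)%N -> f i < f j.
Hypothesis f_infty : forall t, exists N, forall i, (N <= i)%N -> t < f i.
Hypothesis v_gt0 : forall i, 0 < v i.

(** A sufficient condition for [j] to be unobstructed: up to time [s] the bullet
    [j] is active and in front of it all mortal bullets in range have died,
    without involving [j] or bullets out of range.  Replacing the end of [j] by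
    infinity then yields the process on the bullets from [a] to [j]. *)
Lemma unobstructed_last_survives e a j s : process f v setT e -> (a <= j)%N ->
  (s%:E <= e j)%E ->
  (forall i t, (i < j)%N -> e i <> +oo%E -> meets f v i j t ->
    (t%:E <= e i)%E -> (t%:E <= e j)%E -> False) ->
  (forall i, (a <= i < j)%N -> e i = +oo%E -> forall t, ~ meets f v i j t) ->
  (forall i, (i < j)%N -> e i <> +oo%E -> (e i <= s%:E)%E) ->
  (forall i k t, (a <= i < j)%N -> e i <> +oo%E -> (k < a)%N || (j < k)%N ->
     meets f v i k t -> (t%:E <= e i)%E -> (t%:E <= e k)%E -> False) ->
  last_survives f v a j.
Proof.
move=> pe aj sj nocol nosurv dead iso.
exists (fun i => if i == j then +oo%E else e i); last by rewrite eqxx.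
have jE i : (i <= j)%N -> i <> j -> (i < j)%N.
  by move=> ij /eqP nij; rewrite ltn_neqAle nij.
have nocol' i t : (a <= i <= j)%N -> i <> j -> meets f v i j t ->
    (t%:E <= e i)%E -> False.
  move=> /andP[ai le_ij] ij mt ti; have lt_ij := jE _ le_ij ij.
  case: (pselect (e i = +oo%E)) => ei.
    by apply: (nosurv i _ ei t mt); rewrite ai.
  apply: (nocol i t) => //; apply: le_trans sj; apply: le_trans ti _.
  exact: dead.
split=> [i k t /= Ji Jk ik mt|i /= Ji].
  case: eqP => ij; case: eqP => kj.
  - by exfalso; apply: ik; rewrite ij kj.
  - by move=> _ tk; exfalso; apply: (nocol' k t) => //; rewrite -ij; exact: meets_sym.
  - by move=> ti _; exfalso; apply: (nocol' i t) => //; rewrite -kj.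
  - by move=> ti tk; apply: (pe.1 i k t).
case: eqP => ij; first by left.
case: (pe.2 i I) => [|[k [t [_ ik mt ei ek]]]]; [by left|right].
have ejfin : e i <> +oo%E by rewrite ei.
case/andP: (Ji) => ai le_ij; have lt_ij := jE _ le_ij ij.
have [kin|kout] := boolP (a <= k <= j)%N; last first.
  exfalso; apply: (iso i k t) => //; rewrite ?ai ?ei ?ek//.
  by move: kout; rewrite negb_and -!ltnNge.
have kj : k <> j.
  by move=> kj; subst k; apply: (nocol' i t) => //; rewrite ei.
by exists k, t; case: eqP => // _; split.
Qed.

Variables (g : nat -> R) (u : R).
Hypothesis g_lt : forall m, g m < f m.
Hypothesis gS : forall m, g m.+1 = f m.
Hypothesis u_ge0 : 0 <= u.

Let touch j m t := v j * (t - f j) = u * (t - g m).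
Let tau m j := (v j * f j - u * g m) / (v j - u).

(** The ghost starts before [j], so [j] can only touch it from behind. *)
Lemma touch_fast m j t : (m <= j)%N -> f j <= t -> touch j m t ->
  u < v j /\ t = tau m j.
Proof.
move=> mj fjt tch; have gf : g m < f j.
  by rewrite (lt_le_trans (g_lt m))// (fire_le f_incr).
have uv : u < v j.
  rewrite ltNge; apply/negP => vu; move: tch; rewrite /touch => tch.
  have u0 : 0 < u by rewrite (lt_le_trans (v_gt0 j)).
  have : v j * (t - f j) < u * (t - g m).
    apply: (@le_lt_trans _ _ (u * (t - f j))).
      by rewrite ler_wpM2r// subr_ge0.
    by rewrite ltr_pM2l// ltrD2l ltrN2.
  by rewrite tch ltxx.
split=> //; rewrite /tau.
have : v j - u != 0 by rewrite subr_eq0 gt_eqF.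
move=> h; apply: (mulIf h); rewrite divfK//.
by move: tch; rewrite /touch; lra.
Qed.

Lemma tau_touch m j : u < v j -> touch j m (tau m j).
Proof.
move=> uv; rewrite /touch /tau; field.
by rewrite subr_eq0 gt_eqF.
Qed.

(** The heart of the lower bound.  In the proof, [e] is the process on all
    bullets and [a] is the index following its last survivor.  If the
    conclusion failed for [N], then for [n] beyond some index [K],
    [last_survives 0 n] would imply that [n] is not faster than [u], and
    [last_survives a n] that it is not faster than the last survivor.  The
    bullet [j] that first touches a suitable ghost contradicts one of the two. *)
Theorem last_survives_infinitely_often :
  (forall m, ~ ghost_clear f v m u (g m)) ->
  (forall l e, process f v setT e -> e l = +oo%E ->
     exists N, forall n, (N <= n)%N -> last_survives f v l.+1 n -> v n <= v l) ->
  forall N, exists n, [/\ (N <= n)%N, last_survives f v 0 n & u < v n].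
Proof.
move=> noclear slow N; apply: contrapT => noN.
have HN n : (N <= n)%N -> last_survives f v 0 n -> v n <= u.
  by move=> Nn Fn; rewrite leNgt; apply/negP => uvn; apply: noN; exists n.
have [e pe] : exists e, process f v setT e.
  exact/process_exists/fire_locally_finite.
have survN i : e i = +oo%E -> (i < N)%N.
  move=> ei; rewrite ltnNge; apply/negP => Ni.
  have := HN i Ni (survivor_last_survives f_incr v_gt0 pe ei).
  move=> /(survivor_ghost_clear f_incr v_gt0 pe ei); rewrite -gS; exact: noclear.
(* [a] is the index after the last survivor *)
have [a [nosurv aE]] : exists a, (forall i, (a <= i)%N -> e i <> +oo%E) /\
    (a = 0%N \/ exists2 l, a = l.+1 & e l = +oo%E).
  have exN : exists a, `[< forall i, (a <= i)%N -> e i <> +oo%E >].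
    by exists N; apply/asboolP => i Ni /survN; rewrite ltnNge Ni.
  case: (ex_minnP exN) => a /asboolP Pa mina; exists a; split=> //.
  case: a => [|l] in Pa mina *; [by left|right; exists l => //].
  apply: contrapT => el; have : (l < l)%N; last by rewrite ltnn.
  apply: mina; apply/asboolP => i; rewrite leq_eqVlt => /orP[/eqP<-//|].
  exact: Pa.
have aN : (a <= N)%N.
  by case: aE => [->//|[l -> /survN]].
have surv_lt i : e i = +oo%E -> (i < a)%N.
  by move=> ei; rewrite ltnNge; apply/negP => /nosurv.
(* beyond [K], [last_survives] from 0 or from [a] bounds the velocity *)
have [K [NK HK]] : exists K, (N <= K)%N /\
    forall n l, a = l.+1 -> (K <= n)%N -> last_survives f v a n -> v n <= v l.
  case: aE => [a0|[l al el]]; first by exists N; rewrite a0.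
  have [N2 HN2] := slow l e pe el; exists (maxn N N2); split; first exact: leq_maxl.
  move=> n l'; rewrite al => -[<-]; rewrite geq_max => /andP[_ Nn].
  exact: HN2.
have [T0 HT0] : exists T0 : R, forall i, (i < K)%N -> e i <> +oo%E -> (e i <= T0%:E)%E.
  elim: (K) => [|k [T0 HT]]; first by exists 0.
  case E : (e k) => [r| |].
  - exists (Num.max T0 r) => i; rewrite ltnS leq_eqVlt => /orP[/eqP->|ik] ei.
      by rewrite E lee_fin le_max lexx orbT.
    by rewrite (le_trans (HT i ik ei))// lee_fin le_max lexx.
  - exists T0 => i; rewrite ltnS leq_eqVlt => /orP[/eqP->|ik] ei; last exact: HT.
    by rewrite E in ei.
  - exists T0 => i; rewrite ltnS leq_eqVlt => /orP[/eqP->|ik] ei; last exact: HT.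
    by rewrite E leNye.
(* [T] is a firing time, so that at time [T] the bullet [M] has just become
   active and [m], the first non-survivor active after [T], exists *)
have [M0 HM0] := f_infty T0.
pose M := maxn M0 K; pose T := f M.
have T0T : T0 < T by apply: HM0; exact: leq_maxl.
have aM : (a <= M)%N by rewrite (leq_trans aN)// (leq_trans NK)// leq_maxr.
have exm : exists m, (a <= m)%N && (T%:E < e m)%E.
  by exists M; rewrite aM (fire_lt_end f_incr v_gt0 pe).
case: (ex_minnP exm) => m /andP[am Tm] minm.
have Km : (K <= m)%N.
  rewrite leqNgt; apply/negP => mK.
  have /lt_le_trans/(_ (HT0 m mK (nosurv m am))) := Tm.
  by rewrite lte_fin ltNge (ltW T0T).
have dead i : (i < m)%N -> e i <> +oo%E -> (e i <= T%:E)%E.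
  move=> im ei; have [ai|ia] := leqP a i.
    rewrite leNgt; apply/negP => Ti.
    by have := minm i; rewrite ai Ti leqNgt im => /(_ isT).
  have iK : (i < K)%N by rewrite (leq_trans ia)// (leq_trans aN).
  by apply: (le_trans (HT0 i iK ei)); rewrite lee_fin ltW.
(* the bullets from [m] on do not interact with the others *)
have sep i j t : (i < m)%N -> (m <= j)%N -> meets f v i j t ->
    (t%:E <= e i)%E -> (t%:E <= e j)%E -> False.
  move=> im mj mt ti tj.
  have ij : i <> j by move=> E; move: mj; rewrite -E leqNgt im.
  have [ei ej] := process_collide pe I I ij mt ti tj.
  have tT : (t%:E <= T%:E)%E by rewrite -ei; apply: dead => //; rewrite ei.
  move: mj; rewrite leq_eqVlt => /orP[/eqP mj|mj].
    by move: Tm; rewrite mj ej ltNge tT.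
  by apply: (shield f_incr v_gt0 pe _ _ _ im mj mt) => //; exact: le_lt_trans Tm.
(* [P j]: the bullet [j] touches the line of the ghost, at time [tau m j] *)
pose P j := [/\ (m <= j)%N, u < v j, f j <= tau m j & ((tau m j)%:E <= e j)%E].
have [j0 Pj0] : exists j, P j.
  apply: contrapT => noP; apply: (noclear m); exists e.
    apply: (process_restrict pe) => // j i t /= mj _ /negP; rewrite -ltnNge => im.
    by move=> /meets_sym mt tj ti; exact: (sep i j t).
  move=> j t mj fj tj tch; apply: noP; exists j.
  by have [uv tE] := touch_fast mj fj tch; rewrite /P -tE.
(* the first bullet to touch the ghost, and the smallest index if several bullets
   meet on its line *)
have [j Pj jmin] : exists2 j, P j & forall i, P i ->
    tau m j <= tau m i /\ (tau m i = tau m j -> (j <= i)%N).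
  have [N' HN'] := f_infty (tau m j0).
  pose P1 i := P i /\ tau m i <= tau m j0.
  have [|i [[_ _ fi _] ti]|j1 [Pj1 tj1] minj1] := @ex_minimal_lt _ _ P1 (tau m) N'.
  - by exists j0.
  - by rewrite ltnNge; apply/negP => /HN'; rewrite ltNge (le_trans fi).
  have exj : exists j, `[< P j /\ tau m j = tau m j1 >].
    by exists j1; apply/asboolP.
  case: (ex_minnP exj) => j /asboolP[Pj tj] minj; exists j => // i Pi.
  split=> [|ti]; last by apply: minj; apply/asboolP; rewrite -tj.
  rewrite tj; case: (leP (tau m i) (tau m j0)) => ti; first exact: minj1.
  by rewrite (le_trans tj1)// ltW.
case: Pj => mj uv fjt te.
set t := tau m j in fjt te jmin.
have tch := tau_touch m uv.
(* an active bullet between [m] and [j] would be ahead of [j] at time [t], hence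
   would have touched the ghost already *)
have before i : (m <= i < j)%N -> (e i < t%:E)%E.
  move=> /andP[mi ij]; rewrite ltNge; apply/negP => ti.
  have ij' : i <> j by move=> E; rewrite E ltnn in ij.
  have fit : f i <= t by rewrite (le_trans _ fjt)// ltW// f_incr.
  have pos : u * (t - g m) <= v i * (t - f i).
    rewrite -tch; case: (pselect (meets f v i j t)) => [[_ _ ->]//|nmt].
    apply/ltW/(ahead_until_meeting f_incr v_gt0) => // s ms st.
    have st' : (s%:E <= t%:E)%E by rewrite lee_fin.
    have [ei _] := process_collide pe I I ij' ms (le_trans st' ti) (le_trans st' te).
    apply: nmt; suff -> : t = s by [].
    by apply/eqP; rewrite eq_le st andbT -lee_fin -ei.
  have [r [fr rt rpos]] : exists r, [/\ f i <= r, r <= t &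
      u * (r - g m) = v i * (r - f i)].
    apply: affine_crossing => //.
    rewrite subrr mulr0 mulr_ge0// subr_ge0 (le_trans (ltW (g_lt m)))//.
    exact: (fire_le f_incr).
  have [ui rE] := touch_fast mi fr (esym rpos).
  have Pi : P i.
    by split=> //; rewrite -rE// (le_trans _ ti)// lee_fin.
  have [tle teq] := jmin i Pi.
  have : (j <= i)%N by apply: teq; apply/eqP; rewrite eq_le tle -rE rt.
  by rewrite leqNgt ij.
(* [t] may precede [T] when [j = m]; the bullets before [m] are dead by [T] *)
pose s := Num.max t T.
have sj : (s%:E <= e j)%E.
  suff Tj : (T%:E <= e j)%E by rewrite /s; case: (leP t T).
  move: mj; rewrite leq_eqVlt => /orP[/eqP <-|mj]; first exact: ltW.
  have := before m; rewrite leqnn mj => /(_ isT) /(lt_trans Tm) Tt.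
  by rewrite (le_trans _ te)// ltW.
have dead' i : (i < j)%N -> e i <> +oo%E -> (e i <= s%:E)%E.
  move=> ij ei; have [mi|im] := leqP m i.
    have := before i; rewrite mi ij => /(_ isT)/ltW/le_trans; apply.
    by rewrite lee_fin le_max lexx.
  by apply: (le_trans (dead i im ei)); rewrite lee_fin le_max lexx orbT.
have nocol i t' : (i < j)%N -> e i <> +oo%E -> meets f v i j t' ->
    (t'%:E <= e i)%E -> (t'%:E <= e j)%E -> False.
  move=> ij ei mt ti tj; have [mi|im] := leqP m i; last exact: (sep i j t').
  have ij' : i <> j by move=> E; rewrite E ltnn in ij.
  have [ei' ej'] := process_collide pe I I ij' mt ti tj.
  by have := before i; rewrite mi ij ei' -ej' ltNge te => /(_ isT).
have iso c : (c <= a)%N -> c = 0%N \/ c = a -> forall i k t',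
    (c <= i < j)%N -> e i <> +oo%E -> (k < c)%N || (j < k)%N ->
    meets f v i k t' -> (t'%:E <= e i)%E -> (t'%:E <= e k)%E -> False.
  move=> ca cE i k t' /andP[ci ij] ei /orP[kc|jk] mt ti tk.
    case: cE => cE; first by rewrite cE in kc.
    case: aE => [a0|[l al el]]; first by move: kc; rewrite cE a0.
    rewrite cE al ltnS in kc; rewrite cE al in ci.
    by apply: (survivor_isolates f_incr v_gt0 pe el kc ci (meets_sym mt)).
  have [mi|im] := leqP m i.
    apply: (shield f_incr v_gt0 pe _ _ _ ij jk mt) => //.
    have := before i; rewrite mi ij => /(_ isT) it.
    by apply: (lt_le_trans (le_lt_trans ti it)).
  apply: (sep i k t') => //; exact: (leq_trans mj (ltnW jk)).
have aj : (a <= j)%N by exact: leq_trans mj.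
have Fa : last_survives f v a j.
  apply: (unobstructed_last_survives pe aj sj nocol) => //;
    last by apply: iso => //; right.
  by move=> i /andP[ai _] /surv_lt; rewrite ltnNge ai.
suff F0 : last_survives f v 0 j.
  have Nj : (N <= j)%N by rewrite (leq_trans NK)// (leq_trans Km).
  by have := HN j Nj F0; rewrite leNgt uv.
apply: (unobstructed_last_survives pe (leq0n j) sj nocol) => //;
  last by apply: iso => //; left.
move=> i /andP[_ ij] ei t' mt.
case: aE => [a0|[l al el]]; first by have := surv_lt i ei; rewrite a0.
have lj : (l < j)%N by rewrite al in aj.
have vjl : v j <= v l by apply: HK => //; exact: leq_trans mj.
case: mt => fi fj pos.
have flt : f l < f j by exact: f_incr.
have lt1 : v j * (t' - f j) < v l * (t' - f l).
  apply: (@le_lt_trans _ _ (v l * (t' - f j))).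
    by rewrite ler_wpM2r// subr_ge0.
  by rewrite ltr_pM2l// ltrD2l ltrN2.
have : v l * (t' - f l) <= v i * (t' - f i).
  have := surv_lt i ei; rewrite al ltnS leq_eqVlt => /orP[/eqP->//|il].
  apply/ltW/(ahead_until_meeting f_incr v_gt0) => //; first exact: le_trans (ltW flt) fj.
  move=> s' ms _; have il' : i <> l by move=> E; rewrite E ltnn in il.
  have [] : e i = s'%:E /\ e l = s'%:E; last by rewrite ei.
  by apply: (process_collide pe) => //; rewrite ?ei ?el leey.
by rewrite pos leNgt lt1.
Qed.

End front_runner.

(** * Shifted sequences and ghost bullets *)

Section bullet_sequences.
Context {R : realType}.
Implicit Types (b : nat -> R * R) (f v : nat -> R) (e : nat -> \bar R) (u c : R).

Definition shift m b : nat -> R * R := fun i => b (m + i)%N.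

(** The delay of the first bullet has no effect on firing times counted from
    it, whence the value 0. *)
Definition ghost u b : nat -> R * R := fun i => if i is k.+1 then b k else (u, 0).

Lemma fire_time0 b : fire_time b 0 0 = 0.
Proof. by rewrite /fire_time big_geq. Qed.

Lemma fire_timeS b i : fire_time b 0 i.+1 = fire_time b 0 i + (b i.+1).2.
Proof. by rewrite /fire_time big_nat_recr. Qed.

Lemma fire_time_shift b m i :
  fire_time (shift m b) 0 i = fire_time b 0 (m + i) - fire_time b 0 m.
Proof.
elim: i => [|i IH]; first by rewrite fire_time0 addn0 subrr.
by rewrite fire_timeS IH addnS fire_timeS /shift addnS addrAC.
Qed.

Lemma fire_time_ghost u b i :
  fire_time (ghost u b) 0 i.+1 = fire_time b 0 i + (b 0%N).2.
Proof.
elim: i => [|i IH]; first by rewrite fire_timeS !fire_time0.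
by rewrite fire_timeS IH fire_timeS /= addrAC.
Qed.

(** Renumbering from [m] and moving the origin of time to [c] changes
    nothing. *)
Lemma process_reindex f v f' v' J e e' m c :
  (forall i, f' i = f (m + i)%N - c) -> (forall i, v' i = v (m + i)%N) ->
  (forall i, e' i = e (m + i)%N - c%:E)%E -> (forall i, J i -> (m <= i)%N) ->
  process f v J e <-> process f' v' (fun i => J (m + i)%N) e'.
Proof.
move=> fE vE eE Jm.
have mE i j t : meets f' v' i j t <-> meets f v (m + i) (m + j) (t + c).
  rewrite /meets !fE !vE !lerBlDr.
  by rewrite (_ : t + c - f (m + i)%N = t - (f (m + i)%N - c));
     [rewrite (_ : t + c - f (m + j)%N = t - (f (m + j)%N - c))|]; try lra.
have leE i t : (t%:E <= e' i)%E = ((t + c)%:E <= e (m + i)%N)%E.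
  by rewrite eE leeBrDr// EFinD.
have eqE i t : e' i = t%:E <-> e (m + i)%N = (t + c)%:E.
  rewrite eE; case: (e _) => [r| |]//=; split=> -[]; first by move=> <-; congr EFin; lra.
  by move=> ->; congr EFin; lra.
have eqy i : e' i = +oo%E <-> e (m + i)%N = +oo%E by rewrite eE; case: (e _).
split=> -[c1 c2]; split.
- move=> i j t Ji Jj ij /mE mt; rewrite !leE => ti tj; apply/eqE.
  by apply: (c1 _ (m + j)%N) => // /addnI.
- move=> i Ji; case: (c2 _ Ji) => [/eqy|[j [t [Jj ij mt ei ej]]]]; [by left|right].
  have jE := subnKC (Jm _ Jj).
  exists (j - m)%N, (t - c); split; rewrite ?jE//.
  + by move=> E; apply: ij; rewrite E jE.
  + by apply/mE; rewrite jE subrK.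
  + by apply/eqE; rewrite subrK.
  + by apply/eqE; rewrite jE subrK.
- move=> i j t Ji Jj ij mt ti tj.
  have iE := subnKC (Jm _ Ji); have jE := subnKC (Jm _ Jj).
  rewrite -iE -[t](subrK c); apply/eqE; apply: (c1 _ (j - m)%N); rewrite ?iE ?jE//.
  + by move=> E; apply: ij; rewrite -iE E jE.
  + by apply/mE; rewrite iE jE subrK.
  + by rewrite leE iE subrK.
  + by rewrite leE jE subrK.
- move=> i Ji; have iE := subnKC (Jm _ Ji); rewrite -iE in Ji *.
  case: (c2 _ Ji) => [/eqy|[j [t [Jj ij /mE mt /eqE ei /eqE ej]]]]; [by left|right].
  exists (m + j)%N, (t + c); split=> //.
  by move=> /addnI.
Qed.

Lemma potential_survivor_shift b m k :
  potential_survivor (shift m b) k <->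
  last_survives (fire_time b 0) (fun i => (b i).1) m (m + k).
Proof.
pose c := fire_time b 0 m.
pose J := [set i | (m <= i <= m + k)%N].
have JE : (fun i => J (m + i)%N) = [set i | (i <= k)%N].
  by apply/funext => i; rewrite /J /= leq_addr leq_add2l.
have Jm i : J i -> (m <= i)%N by move=> /andP[].
have H e e' : (forall i, e' i = e (m + i)%N - c%:E)%E ->
    process (fire_time b 0) (fun i => (b i).1) J e <->
    process (fire_time (shift m b) 0) (fun i => (shift m b i).1) [set i | (i <= k)%N] e'.
  by move=> eE; rewrite -JE; apply: process_reindex eE Jm => // i; exact: fire_time_shift.
split=> [/survivesE[_ [e' pe' e'k]]|[e pe ek]].
  exists (fun i => e' (i - m)%N + c%:E)%E; last by rewrite addKn e'k.
  by apply/(H _ e') => // i; rewrite addKn addeK.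
apply/survivesE; split; first by move=> t; exists k.+1 => i /=.
exists (fun i => e (m + i)%N - c%:E)%E; last by rewrite ek.
exact/H.
Qed.

Lemma ghost_clear_shift b m u g :
  ghost_clear (fire_time (shift m b) 0) (fun i => (shift m b i).1) 0 u g <->
  ghost_clear (fire_time b 0) (fun i => (b i).1) m u (g + fire_time b 0 m).
Proof.
pose c := fire_time b 0 m.
pose J := [set i | (m <= i)%N].
have JE : (fun i => J (m + i)%N) = [set i | (0 <= i)%N].
  by apply/funext => i; rewrite /J /= leq_addr.
have Jm i : J i -> (m <= i)%N by [].
have H e e' : (forall i, e' i = e (m + i)%N - c%:E)%E ->
    process (fire_time b 0) (fun i => (b i).1) J e <->
    process (fire_time (shift m b) 0) (fun i => (shift m b i).1) [set i | (0 <= i)%N] e'.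
  by move=> eE; rewrite -JE; apply: process_reindex eE Jm => // i; exact: fire_time_shift.
split=> [[e' pe' nt]|[e pe nt]].
  exists (fun i => e' (i - m)%N + c%:E)%E.
    by apply/(H _ e') => // i; rewrite addKn addeK.
  move=> j t mj fj tj; have jE := subnKC mj.
  have := nt (j - m)%N (t - c) isT; rewrite fire_time_shift /shift jE.
  rewrite lerD2r fj EFinB leeBlDr// tj => /(_ isT isT) ne E; apply: ne.
  by rewrite (_ : t - c - _ = t - fire_time b 0 j) ?E /c; [congr *%R; lra|lra].
exists (fun i => e (m + i)%N - c%:E)%E; first exact/H.
move=> j t _; rewrite fire_time_shift lerBlDr => fj; rewrite leeBrDr// -EFinD => tj.
have := nt (m + j)%N (t + c) (leq_addr _ _) fj tj => ne E; apply: ne.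
by rewrite (_ : t + c - _ = t - (fire_time b 0 (m + j) - fire_time b 0 m)) ?E /c;
   [congr *%R; lra|lra].
Qed.

Lemma eq_survives b b' m J i :
  fire_time b m =1 fire_time b' m -> (forall k, (b k).1 = (b' k).1) ->
  survives b m J i <-> survives b' m J i.
Proof.
by move=> /funext fE vE; rewrite !survivesE fE (funext vE).
Qed.

(** The event that defines [theta] depends only on the bullets from index 1
    on. *)
Lemma survives_set_first_velocity u b i :
  survives (set_first_velocity u b) 0 setT i <-> survives (ghost u (shift 1 b)) 0 setT i.
Proof.
apply: eq_survives => [k|[|k]//].
elim: k => [|k IH]; first by rewrite !fire_time0.
by rewrite !fire_timeS IH.
Qed.

(** The almost sure properties of the realisations on which the deterministic
    arguments rest. *)
Record regular b : Prop := Regular {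
  regular_velocity : forall i, 0 < (b i).1;
  regular_delay : forall i, 0 < (b i).2;
  regular_infty : forall t, exists N, forall i, (N <= i)%N -> t < fire_time b 0 i }.

Lemma regular_incr b : regular b ->
  forall i j, (i < j)%N -> fire_time b 0 i < fire_time b 0 j.
Proof.
move=> gb i; elim=> // j IH; rewrite ltnS leq_eqVlt fire_timeS => /orP[/eqP->|/IH ij].
  by rewrite ltrDl regular_delay.
by rewrite (lt_trans ij)// ltrDl regular_delay.
Qed.

Lemma regular_shift b m : regular b -> regular (shift m b).
Proof.
move=> gb; split=> [i|i|t]; [exact: (regular_velocity gb)|exact: (regular_delay gb)|].
have [N HN] := regular_infty gb (t + fire_time b 0 m); exists N => i Ni.
by rewrite fire_time_shift ltrBrDr HN// (leq_trans Ni)// leq_addl.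
Qed.

(** A surviving ghost takes part in no collision, so that removing it leaves the
    process of the others unchanged. *)
Lemma ghost_survives0 b u : regular b ->
  survives (ghost u b) 0 setT 0 <->
  ghost_clear (fire_time b 0) (fun i => (b i).1) 0 u (- (b 0%N).2).
Proof.
move=> gb; pose c := (b 0%N).2; pose f := fire_time (ghost u b) 0.
pose v i := (ghost u b i).1.
have fE i : fire_time b 0 i = f (1 + i)%N - c.
  by rewrite /f add1n fire_time_ghost addrK.
have c0 : 0 < c by exact: regular_delay.
have lf J : locally_finite f J.
  move=> t; have [N HN] := regular_infty gb (t - c); exists N.+1 => i _.
  rewrite ltnNge => fi; apply/negP; case: i fi => // i fi Ni.
  have := HN i Ni; rewrite fE ltrD2r ltNge; move: fi => /=.
  by rewrite add1n => ->.
have f0 : f 0%N = 0 by rewrite /f fire_time0.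
have touchE e e' j t : (forall i, e' i = e (1 + i)%N - c%:E)%E -> e 0%N = +oo%E ->
    [/\ fire_time b 0 j <= t, (t%:E <= e' j)%E
      & (b j).1 * (t - fire_time b 0 j) = u * (t - - c)]
    <-> [/\ f j.+1 <= t + c, ((t + c)%:E <= e j.+1)%E & meets f v j.+1 0 (t + c)].
  move=> eE e0; rewrite fE lerBlDr eE leeBrDr// -EFinD add1n opprK.
  rewrite (_ : t - (f j.+1 - c) = t + c - f j.+1); last by lra.
  split=> [[h1 h2 h3]|[h1 h2 [_ _ h3]]]; split=> //.
    split=> //; first by rewrite f0 (le_trans _ h1)// /f fire_time_ghost addr_ge0//;
      [rewrite -(fire_time0 b); case: (j) => // k; exact/ltW/(regular_incr gb)
      |exact: ltW].
    by rewrite /v /= h3 f0 subr0.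
  by move: h3; rewrite /v /= f0 subr0.
have reindex e e' : (forall i, e' i = e (1 + i)%N - c%:E)%E ->
    process f v [set i | (1 <= i)%N] e <->
    process (fire_time b 0) (fun i => (b i).1) [set i | (0 <= i)%N] e'.
  move=> eE; have := process_reindex fE (v := v) (v' := fun i => (b i).1) _ eE
    (J := [set i | (1 <= i)%N]); apply=> //.
split=> [/survivesE[_ [e pe e0]]|[e' pe' nt]].
  have nomeet i t : (1 <= i)%N -> meets f v i 0 t -> (t%:E <= e i)%E -> False.
    move=> i1 mt ti; have [] : e i = t%:E /\ e 0%N = t%:E; last by rewrite e0.
    by apply: (process_collide pe) => //; [case: (i) i1|rewrite e0 leey].
  pose e' i := (e (1 + i)%N - c%:E)%E; exists e'.
    apply/(reindex e) => //; apply: (process_restrict pe) => // i j t i1 _ /negP.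
    by rewrite -leqNgt leqn0 => /eqP-> mt ti _; exact: (nomeet i t).
  move=> j t _ fj tj E.
  have [_ ej mt] := (touchE e e' j t (fun=> erefl) e0).1 (And3 fj tj E).
  exact: nomeet ej.
apply/survivesE; split; first exact: lf.
pose e i := if i is k.+1 then (e' k + c%:E)%E else +oo%E.
have eE i : e' i = (e (1 + i)%N - c%:E)%E by rewrite /= addeK.
exists e => //.
have [c1 c2] : process f v [set i | (1 <= i)%N] e by apply/(reindex _ e').
have nomeet j t : meets f v j.+1 0 t -> (t%:E <= e j.+1)%E -> False.
  move=> mt tj; have fj : f j.+1 <= t by case: mt.
  have [] := (touchE e e' j (t - c) eE erefl).2; first by rewrite subrK.
  exact: nt.
split=> [[|i] [|j] t _ _ ij mt ti tj|[|i] _] //.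
- by exfalso; apply: (nomeet j t) => //; exact: meets_sym.
- by exfalso; apply: (nomeet i t).
- exact: (c1 i.+1 j.+1).
- by left.
- case: (c2 i.+1 isT) => [|[j [t [/= j0 ij mt ei ej]]]]; [by left|right].
  by exists j, t.
Qed.

End bullet_sequences.

Section ghost_bullets.
Context {R : realType}.
Implicit Types (b : nat -> R * R) (u c : R).

Definition ghost_survives u b : Prop := survives (ghost u b) 0 setT 0.

Lemma ghost_survivesE b m u : regular b ->
  ghost_survives u (shift m b) <->
  ghost_clear (fire_time b 0) (fun i => (b i).1) m u (fire_time b 0 m - (b m).2).
Proof.
move=> gb; rewrite /ghost_survives ghost_survives0; last exact: regular_shift.
by rewrite ghost_clear_shift /shift addn0 addrC.
Qed.

Lemma ghost_survivesSE b m u : regular b ->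
  ghost_survives u (shift m.+1 b) <->
  ghost_clear (fire_time b 0) (fun i => (b i).1) m.+1 u (fire_time b 0 m).
Proof. by move=> gb; rewrite ghost_survivesE// fire_timeS addrK. Qed.

Lemma ghost_survives_unique b u n k : regular b -> 0 <= u -> (n < k)%N ->
  potential_survivor b n -> u < (b n).1 -> ghost_survives u (shift n.+1 b) ->
  potential_survivor b k -> u < (b k).1 -> ghost_survives u (shift k.+1 b) ->
  False.
Proof.
move=> gb u0 nk /(potential_survivor_shift b 0) Fn un /(ghost_survivesSE _ _ gb) Cn.
move=> /(potential_survivor_shift b 0) Fk uk /(ghost_survivesSE _ _ gb) Ck.
exact: (ghost_clear_unique (regular_incr gb) (regular_infty gb) (regular_velocity gb)
  u0 nk un Fn Cn uk Fk Ck).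
Qed.

(** A motionless ghost is hit by the next bullet when that bullet is fired. *)
Lemma ghost0_perishes b : regular b -> ~ ghost_survives 0 b.
Proof.
move=> gb /(ghost_survives0 0 gb)[e pe nt].
have := nt 0%N (fire_time b 0 0%N) (leq0n _) (lexx _).
rewrite subrr mul0r mulr0 => ne; apply: ne => //.
exact/ltW/(fire_lt_end (regular_incr gb) (regular_velocity gb) pe).
Qed.

Lemma potential_survivors_faster b u : regular b -> 0 <= u ->
  (forall m, ~ ghost_survives u (shift m b)) ->
  (forall l, ghost_survives (b l).1 (shift l.+1 b) ->
     exists N, forall n, (N <= n)%N -> potential_survivor (shift l.+1 b) n ->
       (shift l.+1 b n).1 <= (b l).1) ->
  forall N, exists n, [/\ (N <= n)%N, potential_survivor b n & u < (b n).1].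
Proof.
move=> gb u0 noghost slow N.
pose g m := fire_time b 0 m - (b m).2.
have [m|m|m|l e pe el|n [Nn Fn un]] :=
  last_survives_infinitely_often (regular_incr gb) (regular_infty gb)
  (regular_velocity gb) (g := g) _ _ u0 _ _ N; last first.
- by exists n; split=> //; exact/(potential_survivor_shift b 0).
- have := survivor_ghost_clear (regular_incr gb) (regular_velocity gb) pe el (lexx _).
  move=> /(ghost_survivesSE _ _ gb)/slow[N' HN']; exists (l.+1 + N')%N => n Nn Fn.
  have ln : (l.+1 <= n)%N by rewrite (leq_trans _ Nn)// leq_addr.
  have := HN' (n - l.+1)%N; rewrite potential_survivor_shift /shift subnKC//; apply=> //.
  by rewrite leq_subRL.
- by move=> /(ghost_survivesE _ _ gb); exact: noghost.
- by rewrite /g fire_timeS addrK.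
- by rewrite /g ltrBlDr ltrDl regular_delay.
Qed.

End ghost_bullets.

Section regular_sequences.
Context {R : realType}.
Implicit Types (b : nat -> R * R) (u : R).

Lemma ghost_survives_le b u u' : regular b -> 0 <= u -> u <= u' ->
  ghost_survives u b -> ghost_survives u' b.
Proof.
move=> gb u0 uu' /(ghost_survives0 _ gb)[e pe nt]; apply/(ghost_survives0 _ gb).
have gf : - (b 0%N).2 < fire_time b 0 0 by rewrite fire_time0 oppr_lt0 regular_delay.
exists e => // j t mj fj tj E.
have := behind_line (regular_incr gb) u0 gf nt mj fj tj; rewrite E ltNge ler_wpM2r//.
rewrite subr_ge0 (le_trans (ltW gf))// (le_trans _ fj)//.
exact: (fire_le (regular_incr gb)).
Qed.

Lemma eq_potential_survivor b b' n : (forall i, (i <= n)%N -> b i = b' i) ->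
  potential_survivor b n -> potential_survivor b' n.
Proof.
move=> bb' /survivesE[_ [e pe en]]; apply/survivesE; split.
  by move=> t; exists n.+1.
exists e => //.
have fE i : (i <= n)%N -> fire_time b 0 i = fire_time b' 0 i.
  elim: i => [|i IH] ilen; first by rewrite !fire_time0.
  by rewrite !fire_timeS IH ?bb'// ltnW.
have mE i j t : (i <= n)%N -> (j <= n)%N ->
    meets (fire_time b 0) (fun i => (b i).1) i j t <->
    meets (fire_time b' 0) (fun i => (b' i).1) i j t.
  by move=> ilen jlen; rewrite /meets !fE// !bb'.
split=> [i j t ilen jlen ij /mE mt|i ilen]; first by apply: (pe.1 i j) => //; exact: mt.
case: (pe.2 i ilen) => [|[j [t [jlen ij mt ei ej]]]]; [by left|right].
by exists j, t; split=> //; exact/mE.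
Qed.

(** Infinitely many delays exceed a fixed positive number, so firing times are
    unbounded. *)
Lemma regular_of_large_delays b (dlt : R) :
  (forall i, 0 < (b i).1) -> (forall i, 0 < (b i).2) ->
  0 < dlt -> (forall m, exists i, dlt < (b (m + i)%N).2) -> regular b.
Proof.
move=> v0 d0 dlt0 io; split=> // t.
have mono i j : (i <= j)%N -> fire_time b 0 i <= fire_time b 0 j.
  elim: j => [|j IH]; first by rewrite leqn0 => /eqP->.
  rewrite leq_eqVlt ltnS => /orP[/eqP->//|/IH /le_trans]; apply.
  by rewrite fire_timeS lerDl ltW.
have H (k : nat) : exists N, k%:R * dlt <= fire_time b 0 N.
  elim: k => [|k [N HN]]; first by exists 0%N; rewrite mul0r fire_time0.
  have [i di] := io N.+1; exists (N.+1 + i)%N.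
  rewrite addSn fire_timeS -addn1 natrD mulrDl mul1r lerD//; last by rewrite -addSn ltW.
  by rewrite (le_trans HN)// mono// leq_addr.
have [N HN] := H (Num.bound (`|t| / dlt)); exists N => i Ni.
rewrite (lt_le_trans _ (mono _ _ Ni))// (lt_le_trans _ HN)// -ltr_pdivrMr//.
rewrite (le_lt_trans _ (archi_boundP _))//; last by rewrite divr_ge0// ltW.
by rewrite ler_pM2r ?invr_gt0// ler_norm.
Qed.

End regular_sequences.

(** * The limit superior along the potential survivors *)

Section limsup_of_potential_survivors.
Context {R : realType}.
Variable b : nat -> R * R.
Hypothesis infinitely_many : forall N, exists2 n, (N <= n)%N & potential_survivor b n.

Let before n := (\sum_(i < n) `[< potential_survivor b i >])%N.

Let beforeS n : before n.+1 = (before n + `[< potential_survivor b n >])%N.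
Proof. by rewrite /before big_ord_recr. Qed.

Let before_le n m : (n <= m)%N -> (before n <= before m)%N.
Proof.
elim: m => [|m IH]; first by rewrite leqn0 => /eqP->.
rewrite leq_eqVlt ltnS => /orP[/eqP->//|/IH /leq_trans]; apply.
by rewrite beforeS leq_addr.
Qed.

Let before_lt n m : (n < m)%N -> potential_survivor b n -> (before n < before m)%N.
Proof.
move=> nm pn; apply: leq_trans (before_le nm).
by rewrite beforeS; case: asboolP => //; rewrite addn1.
Qed.

Lemma nth_potential_survivorE n : potential_survivor b n ->
  nth_potential_survivor b (before n) = n.
Proof.
move=> pn; rewrite /nth_potential_survivor; case: xgetP => [m _ [/= pm mE]|/(_ n)[]//].
have {}mE : before m = before n := mE.
by case: (ltngtP m n) => // [/before_lt/(_ pm)|/before_lt/(_ pn)]; rewrite mE ltnn.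
Qed.

Lemma before_unbounded k : exists N, forall n, (N <= n)%N -> (k <= before n)%N.
Proof.
elim: k => [|k [N HN]]; first by exists 0%N.
have [n Nn pn] := infinitely_many N; exists n.+1 => m nm.
by apply: leq_ltn_trans (HN n Nn) _; exact: before_lt.
Qed.

(** The potential survivor preceded by exactly [k] others: it is found just
    before the count first exceeds [k]. *)
Lemma nth_potential_survivorP k :
  potential_survivor b (nth_potential_survivor b k) /\
  before (nth_potential_survivor b k) = k.
Proof.
rewrite /nth_potential_survivor; case: xgetP => [m _ //|none].
exfalso; have [N HN] := before_unbounded k.+1.
have exn : exists n, (k < before n)%N by exists N; exact: HN.
case: (ex_minnP exn) => -[|n]; first by rewrite /before big_ord0.
rewrite beforeS => kn minn.
have nk : (before n <= k)%N.
  by rewrite leqNgt; apply/negP => /minn; rewrite ltnn.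
case: asboolP kn => [pn|_]; last by rewrite addn0 ltnNge nk.
rewrite addn1 ltnS => kn; apply: (none n); split=> //.
by apply/eqP; rewrite eqn_leq nk.
Qed.

Lemma nth_potential_survivor_ge k : (k <= nth_potential_survivor b k)%N.
Proof.
have [_] := nth_potential_survivorP k; set n := nth_potential_survivor b k => {1}<-.
by rewrite /before -[leqRHS](card_ord n) -sum1_card leq_sum// => i _; case: asboolP.
Qed.

Lemma vhat_le u :
  (exists N, forall n, (N <= n)%N -> potential_survivor b n -> (b n).1 <= u) ->
  (vhat b <= u%:E)%E.
Proof.
move=> [N HN]; rewrite /vhat /limn_esup /limf_esup.
apply: (@le_trans _ _ (ereal_sup
  ((fun k => ((b (nth_potential_survivor b k)).1)%:E) @` [set k | (N <= k)%N]))).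
  by apply: ereal_inf_lbound; exists [set k | (N <= k)%N] => //; exists N.
apply: ge_ereal_sup => _ [k /= Nk <-]; rewrite lee_fin; apply: HN.
  exact: leq_trans (nth_potential_survivor_ge k).
by have [] := nth_potential_survivorP k.
Qed.

Lemma vhat_ge u :
  (forall N, exists n, [/\ (N <= n)%N, potential_survivor b n & u < (b n).1]) ->
  (u%:E <= vhat b)%E.
Proof.
move=> io; apply: le_ereal_inf_tmp => _ [V [K _ KV] <-].
have [N HN] := before_unbounded K; have [n [Nn pn un]] := io N.
apply: (@le_trans _ _ (b n).1%:E); first by rewrite lee_fin ltW.
apply: ereal_sup_ubound; exists (before n); first by apply: KV; exact: HN.
by rewrite nth_potential_survivorE.
Qed.

End limsup_of_potential_survivors.

(** * Measurability of survival *)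

Section measurable_propositions.
Context d (T : measurableType d).
Implicit Types Q : T -> Prop.

Lemma measurable_propT Q : (forall x, Q x) -> measurable [set x | Q x].
Proof.
move=> allQ; rewrite (_ : [set x | Q x] = setT); first exact: measurableT.
by apply/seteqP; split=> x //= _.
Qed.

Lemma measurable_propF Q : (forall x, ~ Q x) -> measurable [set x | Q x].
Proof.
move=> noQ; rewrite (_ : [set x | Q x] = set0); first exact: measurable0.
by apply/seteqP; split=> x // /noQ.
Qed.

Lemma measurable_not Q : measurable [set x | Q x] -> measurable [set x | ~ Q x].
Proof. exact: measurableC. Qed.

Lemma measurable_conj Q1 Q2 : measurable [set x | Q1 x] -> measurable [set x | Q2 x] ->
  measurable [set x | Q1 x /\ Q2 x].
Proof. exact: measurableI. Qed.

Lemma measurable_disj Q1 Q2 : measurable [set x | Q1 x] -> measurable [set x | Q2 x] ->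
  measurable [set x | Q1 x \/ Q2 x].
Proof. exact: measurableU. Qed.

Lemma measurable_impl Q1 Q2 : measurable [set x | Q1 x] -> measurable [set x | Q2 x] ->
  measurable [set x | Q1 x -> Q2 x].
Proof.
move=> m1 m2; rewrite (_ : [set x | _] = [set x | ~ Q1 x \/ Q2 x]).
  by apply: measurable_disj => //; exact: measurable_not.
by apply/seteqP; split=> x /=; case: (pselect (Q1 x)); tauto.
Qed.

Lemma measurable_if_prop (C : Prop) Q : (C -> measurable [set x | Q x]) ->
  measurable [set x | C -> Q x].
Proof.
move=> mQ; case: (pselect C) => [c|nc]; last by apply: measurable_propT.
rewrite (_ : [set x | _] = [set x | Q x]); first exact: mQ.
by apply/seteqP; split=> x /=; tauto.
Qed.

Lemma measurable_forall (Q : nat -> T -> Prop) :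
  (forall n, measurable [set x | Q n x]) -> measurable [set x | forall n, Q n x].
Proof.
move=> mQ; rewrite (_ : [set x | _] = \bigcap_n [set x | Q n x]).
  exact: bigcapT_measurable.
by apply/seteqP; split=> x /= Qx n; [move=> _|]; exact: Qx.
Qed.

Lemma measurable_exists (I : countType) (Q : I -> T -> Prop) :
  (forall i, measurable [set x | Q i x]) -> measurable [set x | exists i, Q i x].
Proof.
move=> mQ; rewrite (_ : [set x | _] = \bigcup_n
    (if unpickle n is Some i then [set x | Q i x] else set0)).
  by apply: bigcupT_measurable => n; case: unpickle => [i|].
apply/seteqP; split=> x /=.
  by move=> [i Qi]; exists (pickle i) => //; rewrite pickleK.
by move=> [n _]; case: unpickle => [i Qi|//]; exists i.
Qed.

Lemma measurable_prop_le (R : realType) (g h : T -> \bar R) :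
  measurable_fun setT g -> measurable_fun setT h -> measurable [set x | (g x <= h x)%E].
Proof. by move=> mg mh; rewrite -[X in measurable X]setTI; exact: measurable_lee. Qed.

Lemma measurable_prop_lt (R : realType) (g h : T -> \bar R) :
  measurable_fun setT g -> measurable_fun setT h -> measurable [set x | (g x < h x)%E].
Proof. by move=> mg mh; rewrite -[X in measurable X]setTI; exact: measurable_lte. Qed.

Lemma measurable_prop_eq (R : realType) (g h : T -> \bar R) :
  measurable_fun setT g -> measurable_fun setT h -> measurable [set x | g x = h x].
Proof. by move=> mg mh; rewrite -[X in measurable X]setTI; exact: measurable_eqe. Qed.

End measurable_propositions.

Section cylinder_sigma_algebra.
Context d (E : measurableType d).

Definition cylinder (A : nat -> set E) : set (nat -> E) := [set b | forall i, A i (b i)].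

(** Boxes with finitely many constrained coordinates: a pi-system that generates
    the product sigma-algebra, whose probabilities are finite products. *)
Definition cylinders : set (set (nat -> E)) :=
  [set C | exists A, [/\ forall i, measurable (A i),
     exists n, forall i, (n <= i)%N -> A i = setT & C = cylinder A]].

Definition sequences := g_sigma_algebraType cylinders.

Lemma setI_closed_cylinders : setI_closed cylinders.
Proof.
move=> _ _ [A [mA [n An] ->]] [B [mB [m Bm] ->]].
exists (fun i => A i `&` B i); split=> [i||].
- exact: measurableI.
- exists (maxn n m) => i; rewrite geq_max => /andP[ni mi].
  by rewrite An// Bm// setTI.
- by apply/seteqP; split=> b /= => [[Ab Bb] i|Ab]; [split|split=> i; have [] := Ab i].
Qed.

Lemma cylindersT : cylinders setT.
Proof.
exists (fun=> setT); split=> //; first by exists 0%N.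
by apply/seteqP; split.
Qed.

Lemma measurable_coordinate i : measurable_fun setT (fun b : sequences => b i).
Proof.
move=> _ A mA; rewrite setTI; apply: sub_sigma_algebra.
exists (fun j => if j == i then A else setT); split=> [j||].
- by case: eqP.
- by exists i.+1 => j; case: eqP => // ->; rewrite ltnn.
- apply/seteqP; split=> b /= => [Ab j|/(_ i)]; last by rewrite eqxx.
  by case: eqP => // ->.
Qed.

Lemma measurable_sequence d' (T : measurableType d') (h : T -> sequences) :
  (forall i, measurable_fun setT (fun x => h x i)) -> measurable_fun setT h.
Proof.
move=> mh; apply: (@measurability _ _ T sequences setT h cylinders erefl).
move=> _ [_ [A [mA _ ->]] <-].
rewrite setTI; apply: measurable_forall => i.
by rewrite -[X in measurable X]setTI; exact: mh.
Qed.

End cylinder_sigma_algebra.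

Section measurable_survival.
Context {R : realType}.
Let E := (measurableTypeR R * measurableTypeR R)%type.
Let S := sequences E.
Implicit Types (b : S) (u : R).

Lemma measurable_inv : measurable_fun setT (GRing.inv : R -> R).
Proof.
rewrite (_ : setT = [set x : R | x != 0] `|` [set 0]); last first.
  by apply/seteqP; split=> x //= _; case: (eqVneq x 0); [right|left].
have o0 : open [set x : R | x != 0].
  rewrite (_ : [set x | _] = ~` [set 0]); last first.
    by apply/seteqP; split=> x /= /eqP.
  by rewrite openC; exact: closed_eq.
apply/measurable_funU => //; first exact: open_measurable.
split; last exact: measurable_fun_set1.
apply: open_continuous_measurable_fun => //.
by apply/in_setP => x /= x0; exact: inv_continuous.
Qed.

Lemma measurable_velocity i : measurable_fun setT (fun b : S => (b i).1 : R).
Proof. exact: (measurableT_comp measurable_fst (measurable_coordinate (E := E) i)). Qed.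

Lemma measurable_delay i : measurable_fun setT (fun b : S => (b i).2 : R).
Proof. exact: (measurableT_comp measurable_snd (measurable_coordinate (E := E) i)). Qed.

Lemma measurable_fire_time i : measurable_fun setT (fun b : S => fire_time b 0 i).
Proof.
by apply: measurable_sum => j; exact: measurable_delay.
Qed.

Lemma measurable_meeting_time i j : measurable_fun setT
  (fun b : S => meeting_time (fire_time b 0) (fun k => (b k).1) i j).
Proof.
have mv := measurable_velocity; have mf := measurable_fire_time.
have mE : measurable_fun setT (fun b : S => (b i).1 == (b j).1).
  exact: measurable_fun_eqr.
have mnum : measurable_fun setT
    (fun b : S => (b i).1 * fire_time b 0 i - (b j).1 * fire_time b 0 j).
  by apply: measurable_funB; exact: measurable_funM.
have mmax : measurable_fun setT (fun b : S => Num.max (fire_time b 0 i) (fire_time b 0 j)).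
  exact: measurable_maxr.
have mt : measurable_fun setT (fun b : S => if (b i).1 == (b j).1
    then Num.max (fire_time b 0 i) (fire_time b 0 j)
    else ((b i).1 * fire_time b 0 i - (b j).1 * fire_time b 0 j) / ((b i).1 - (b j).1)).
  apply: measurable_fun_ifT => //; apply: measurable_funM => //.
  by apply: (measurableT_comp measurable_inv); exact: measurable_funB.
apply: measurable_fun_ifT => //; last exact/measurable_EFinP.
apply: measurable_and; last exact: measurable_fun_ler.
rewrite (_ : (fun _ => _) = (fun b : S => ~~ (((b i).1 == (b j).1) &&
    ~~ ((b i).1 * fire_time b 0 i - (b j).1 * fire_time b 0 j == 0)))); last first.
  by apply/funext => b; rewrite implybE negb_and negbK.
apply/measurable_neg/measurable_and => //; apply/measurable_neg.
by apply: measurable_fun_eqr => //; exact: measurable_cst.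
Qed.

End measurable_survival.

Section guessing_partners.
Context {R : realType}.
Variable M : nat -> nat -> \bar R.
Hypothesis M_sym : forall i j, M i j = M j i.

Lemma eq_annihilation J e e' : (forall i, J i -> e i = e' i) ->
  annihilation M J e -> annihilation M J e'.
Proof.
move=> ee' [c1 c2]; split=> [i j Ji Jj|i Ji]; first by rewrite -!ee'//; exact: c1.
rewrite -ee'//; case: (c2 i Ji) => [|[j [Jj ij Mf Mi Mj]]]; [by left|right].
by exists j; rewrite -ee'.
Qed.

(** The code [0] stands for survival and [j.+1] for annihilation with [j].  Codes
    are finite sequences of numbers so that there are countably many. *)
Definition guess (a : seq nat) i : \bar R := if nth 0%N a i is j.+1 then M i j else +oo%E.

(** Every end is infinite or is a meeting time, so some guess is correct. *)
Lemma annihilation_guess J n e : (forall i, J i -> (i < n)%N) -> annihilation M J e ->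
  exists a, forall i, J i -> guess a i = e i.
Proof.
move=> Jn ann.
have /choice[p pP] : forall i, exists k : nat, J i ->
    (if k is j.+1 then M i j else +oo%E) = e i.
  move=> i; case: (pselect (J i)) => [Ji|nJ]; last by exists 0%N.
  case: (pselect (e i = +oo%E)) => [->|ei]; first by exists 0%N.
  by have [j [_ _ Mij _]] := annihilation_partner M_sym ann Ji ei; exists j.+1.
exists (mkseq p n) => i Ji; rewrite /guess nth_mkseq; last exact: Jn.
exact: pP.
Qed.

End guessing_partners.

Section measurable_survival_events.
Context {R : realType}.
Let E := (measurableTypeR R * measurableTypeR R)%type.
Let S := sequences E.
Let f (b : S) : nat -> R := fire_time b 0.
Let v (b : S) : nat -> R := fun i => (b i).1.
Let M (b : S) := meeting_time (f b) (v b).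

Lemma measurable_guess a i : measurable_fun setT (fun b => guess (M b) a i).
Proof.
rewrite /guess; case: nth => [|j]; first exact: measurable_cst.
exact: measurable_meeting_time.
Qed.

Lemma measurable_annihilation (J : set nat) (e : S -> nat -> \bar R) :
  (forall i, measurable_fun setT (fun b => e b i)) ->
  measurable [set b | annihilation (M b) J (e b)].
Proof.
move=> me; have mM i j : measurable_fun setT (fun b => M b i j).
  exact: measurable_meeting_time.
have my : measurable_fun setT (fun _ : S => +oo%E : \bar R) by exact: measurable_cst.
apply: measurable_conj.
  apply: measurable_forall => i; apply: measurable_forall => j.
  do 3 (apply: measurable_if_prop => ?).
  apply: measurable_impl; first exact: (measurable_prop_lt (mM i j) my).
  apply: measurable_impl; first exact: (measurable_prop_le (mM i j) (me i)).
  apply: measurable_impl; first exact: (measurable_prop_le (mM i j) (me j)).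
  exact: (measurable_prop_eq (me i) (mM i j)).
apply: measurable_forall => i; apply: measurable_if_prop => _.
apply: measurable_disj; first exact: (measurable_prop_eq (me i) my).
apply: measurable_exists => j.
rewrite (_ : [set b | _] = [set b | (J j /\ i <> j) /\ ((M b i j < +oo)%E /\
  ((M b i j <= e b i)%E /\ (M b i j <= e b j)%E))]); last first.
  by apply/seteqP; split=> b /= [] //; case=> ? ? [? []].
apply: measurable_conj.
  by case: (pselect (J j /\ i <> j)) => h;
    [apply: measurable_propT|apply: measurable_propF => ?].
apply: measurable_conj; first exact: (measurable_prop_lt (mM i j) my).
apply: measurable_conj; first exact: (measurable_prop_le (mM i j) (me i)).
exact: (measurable_prop_le (mM i j) (me j)).
Qed.

(** A countable union over the guesses of partners. *)
Lemma measurable_finite_process k i (Q : \bar R -> Prop) : (i <= k)%N ->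
  (forall h : S -> \bar R, measurable_fun setT h -> measurable [set b | Q (h b)]) ->
  measurable [set b | exists2 e, process (f b) (v b) [set i | (i <= k)%N] e & Q (e i)].
Proof.
move=> ik mQ; rewrite (_ : [set b | _] = [set b | exists a : seq nat,
    annihilation (M b) [set i | (i <= k)%N] (guess (M b) a) /\ Q (guess (M b) a i)]).
  apply: measurable_exists => a; apply: measurable_conj.
    by apply: measurable_annihilation => j; exact: measurable_guess.
  by apply: mQ; exact: measurable_guess.
apply/seteqP; split=> b /= => [[e /process_annihilation ann Qe]|[a [ann Qa]]].
  have [a aE] := annihilation_guess (@meeting_time_sym _ (f b) (v b)) (n := k.+1)
    (fun i h => h) ann.
  exists a; split; last by rewrite aE.
  by apply: eq_annihilation ann => j jk; rewrite aE.
by exists (guess (M b) a) => //; exact/process_annihilation.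
Qed.

Lemma measurable_potential_survivor n : measurable [set b : S | potential_survivor b n].
Proof.
rewrite (_ : [set b | _] = [set b | exists2 e,
    process (f b) (v b) [set i | (i <= n)%N] e & e n = +oo%E]).
  apply: (measurable_finite_process (Q := fun x => x = +oo%E)) => // h mh.
  by apply: measurable_prop_eq => //; exact: measurable_cst.
apply/seteqP; split=> b /=; first by move=> /survivesE[].
by move=> pe; apply/survivesE; split=> // t; exists n.+1.
Qed.

(** By [process_agree], for each [n] a long enough initial segment decides
    whether the first bullet is still active at time [n]. *)
Lemma survives_setTE (b : S) : survives b 0 setT 0 <->
  (forall n : nat, exists N, forall i, f b i <= n%:R -> (i < N)%N) /\
  (forall n : nat, exists N, forall k, (N <= k)%N ->
    exists2 e, process (f b) (v b) [set i | (i <= k)%N] e & (n%:R%:E < e 0%N)%E).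
Proof.
have lfin J k : J = [set i | (i <= k)%N] -> locally_finite (f b) J.
  by move=> -> t; exists k.+1.
have agree e e' (n k N : nat) : process (f b) (v b) setT e ->
    process (f b) (v b) [set i | (i <= k)%N] e' ->
    (forall i, f b i <= n%:R -> (i < N)%N) -> (N <= k)%N ->
    (e 0%N <= n%:R%:E)%E \/ (e' 0%N <= n%:R%:E)%E -> e 0%N = e' 0%N.
  move=> pe pe' HN Nk; apply: (process_agree _ _ pe pe') => //.
    by exists N => i _; exact: HN.
  by move=> i /HN iN; split=> // _; rewrite /= (leq_trans (ltnW iN)).
split=> [/survivesE[lf [e pe e0]]|[lf H]].
  split=> n; have [N HN] := lf n%:R.
    by exists N => i; exact: HN.
  exists N => k Nk; have [e' pe'] := process_exists (v b) (lfin _ k erefl).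
  exists e' => //; rewrite ltNge; apply/negP => e'n.
  move: (e'n); rewrite -(agree e e' n k N pe pe' (fun i => HN i I) Nk (or_intror e'n)).
  by rewrite e0.
have lf' : locally_finite (f b) setT.
  move=> t; have [N HN] := lf (Num.bound `|t|); exists N => i _ ft; apply: HN.
  by rewrite (le_trans ft)// (le_trans (ler_norm _))// ltW// archi_boundP.
apply/survivesE; split=> //; have [e pe] := process_exists (v b) lf'; exists e => //.
apply: contrapT => e0.
have [n en] : exists n : nat, (e 0%N <= n%:R%:E)%E.
  case: (e 0%N) e0 => [r| |] // _; last by exists 0%N; rewrite leNye.
  exists (Num.bound `|r|).
  by rewrite lee_fin (le_trans (ler_norm _))// ltW// archi_boundP.
have [N HN] := lf n; have [N' HN'] := H n.
have [|e' pe'] := HN' (maxn N N'); first exact: leq_maxr.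
rewrite ltNge -(agree e e' n _ N pe pe' HN (leq_maxl _ _) (or_introl en)).
by rewrite en.
Qed.

Lemma measurable_survives_setT : measurable [set b : S | survives b 0 setT 0].
Proof.
rewrite (eq_set (fun b => propext (survives_setTE b))).
apply: measurable_conj.
  apply: measurable_forall => n; apply: measurable_exists => N.
  apply: measurable_forall => i; apply: measurable_impl.
    under eq_set do rewrite -lee_fin.
    apply: measurable_prop_le; last exact: measurable_cst.
    by apply/measurable_EFinP; exact: measurable_fire_time.
  by case: (ltnP i N) => h; [apply: measurable_propT|apply: measurable_propF => ?].
apply: measurable_forall => n; apply: measurable_exists => N.
apply: measurable_forall => k; apply: measurable_if_prop => Nk.
apply: (measurable_finite_process (Q := fun x => (n%:R%:E < x)%E)) => // h mh.
by apply: measurable_prop_lt => //; exact: measurable_cst.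
Qed.

Lemma measurable_ghost u : measurable_fun setT (ghost u : S -> S).
Proof.
apply: measurable_sequence => -[|k]; first exact: measurable_cst.
exact: measurable_coordinate.
Qed.

Lemma measurable_ghost_survives u : measurable [set b : S | ghost_survives u b].
Proof.
have := measurable_ghost u measurableT measurable_survives_setT.
by rewrite setTI.
Qed.

End measurable_survival_events.

(** * Independent and identically distributed sequences *)

Section iid_sequence.
Context {R : realType} {d : measure_display} {T : measurableType d}.
Variable P : probability T R.
Context {d' : measure_display} {E : measurableType d'}.
Local Notation S := (sequences E).

Lemma eq_on_cylinders (m1 m2 : {measure set S -> \bar R}) :
  (m1 setT < +oo)%E -> (forall C, cylinders C -> m1 C = m2 C) ->
  forall F, measurable F -> m1 F = m2 F.
Proof.
move=> fin m12 F mF.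
apply: (@measure_unique _ _ S (cylinders (E := E)) (fun=> setT) erefl) => //.
- exact: setI_closed_cylinders.
- by move=> _; exact: cylindersT.
- by apply/seteqP; split=> // x _; exists 0%N.
Qed.

(** The two sides are finite measures in [F] that agree on a generating
    pi-system. *)
Lemma independent_of_cylinders (U : {mfun T >-> S}) (D : set T) : measurable D ->
  (forall C, cylinders C -> (P (U @^-1` C `&` D) = P (U @^-1` C) * P D)%E) ->
  forall F, measurable F -> (P (U @^-1` F `&` D) = P (U @^-1` F) * P D)%E.
Proof.
move=> mD indC F mF.
have PD : P D = (fine (P D))%:E by rewrite fineK// fin_num_measure.
have PD0 : 0 <= fine (P D) by exact: fine_ge0.
rewrite PD muleC.
pose m1 : {measure set S -> \bar R} := pushforward (mrestr P mD) U.
pose m2 : {measure set S -> \bar R} := mscale (NngNum PD0) (pushforward P U).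
have mU : measurable_fun setT U by exact: measurable_funPT.
suff : m1 mU F = m2 mU F by [].
apply: eq_on_cylinders => //.
  rewrite /m1 /= /pushforward /mrestr preimage_setT setTI.
  by rewrite (le_lt_trans (probability_le1 _ _))// ltry.
move=> C CC; rewrite /m1 /m2 /= /mscale/= /pushforward /mrestr/= indC//.
by rewrite muleC {1}PD.
Qed.

Variable X : nat -> {RV P >-> E}.
Hypothesis X_indep : mutually_independent X.
Hypothesis X_ident : forall i A, measurable A -> P (X i @^-1` A) = P (X 0%N @^-1` A).

Lemma prob_box (C : nat -> set E) N : (forall i, measurable (C i)) ->
  P [set w | forall j, (j < N)%N -> C j (X j w)] =
  (\prod_(0 <= j < N) P (X j @^-1` C j))%E.
Proof.
move=> mC; have := X_indep (iota_uniq 0 N) mC.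
rewrite /index_iota subn0 => <-; congr (P _).
apply/seteqP; split=> w /= Cw j; first by rewrite /= mem_iota => /Cw.
by move=> jN; apply: Cw; rewrite /= mem_iota.
Qed.

Definition future m w : S := fun i => X (m + i)%N w.
(** The first [n.+1] bullets, encoded as an infinite sequence by repeating the
    last of them, which avoids choosing a default bullet. *)
Definition past n w : S := fun i => X (minn i n) w.

Let measurable_X i : measurable_fun setT (X i).
Proof. exact: measurable_funPT. Qed.

Lemma measurable_future m : measurable_fun setT (future m).
Proof. by apply: measurable_sequence => i; exact: measurable_X. Qed.

Lemma measurable_past n : measurable_fun setT (past n).
Proof. by apply: measurable_sequence => i; exact: measurable_X. Qed.

HB.instance Definition _ m :=
  isMeasurableFun.Build _ _ _ _ (future m) (measurable_future m).
HB.instance Definition _ n :=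
  isMeasurableFun.Build _ _ _ _ (past n) (measurable_past n).

Lemma prob_future_cylinder m A N : (forall i, measurable (A i)) ->
  (forall i, (N <= i)%N -> A i = setT) ->
  P (future m @^-1` cylinder A) = (\prod_(0 <= i < N) P (X 0%N @^-1` A i))%E.
Proof.
move=> mA AN; pose C j := if (j < m)%N then setT else A (j - m)%N.
have mC j : measurable (C j) by rewrite /C; case: ifP.
have -> : future m @^-1` cylinder A = [set w | forall j, (j < m + N)%N -> C j (X j w)].
  apply/seteqP; split=> w /= Aw.
    move=> j _; rewrite /C; case: ltnP => // mj.
    by have := Aw (j - m)%N; rewrite /future subnKC.
  move=> i; case: (ltnP i N) => [iN|/AN->//].
  by have := Aw (m + i)%N; rewrite /C ltn_add2l iN ltnNge leq_addr addKn; apply.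
rewrite prob_box// (big_cat_nat_idem _ (n := m)) ?leq_addr//=; last by rewrite mule1.
rewrite big_nat big1 ?mul1e; last first.
  by move=> j /andP[_ jm]; rewrite /C jm preimage_setT probability_setT.
rewrite -{1}[m]add0n big_addn addKn; apply: eq_bigr => i _.
by rewrite /C ltnNge leq_addl/= addnK X_ident.
Qed.

Lemma stationary m F : measurable F -> P (future m @^-1` F) = P (future 0 @^-1` F).
Proof.
move=> mF.
pose m1 k : {measure set S -> \bar R} := distribution P (future k).
suff : m1 m F = m1 0%N F by [].
apply: eq_on_cylinders => //.
  by rewrite /m1 /= /distribution /pushforward preimage_setT probability_setT ltry.
move=> _ [A [mA [N AN] ->]].
by rewrite /m1 /= /distribution /pushforward !(prob_future_cylinder _ mA AN).
Qed.

Lemma past_future_independent n F G : measurable F -> measurable G ->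
  (P (past n @^-1` F `&` future n.+1 @^-1` G) =
   P (past n @^-1` F) * P (future n.+1 @^-1` G))%E.
Proof.
have mpre (U : {mfun T >-> S}) (H : set S) : measurable H -> measurable (U @^-1` H).
  by move=> mH; rewrite -[X in measurable X]setTI; exact: (measurable_funPT U).
have mcyl (C : set S) : cylinders C -> measurable C.
  by move=> cC; exact: sub_sigma_algebra.
move=> mF mG; apply: (@independent_of_cylinders (past n)) => //; first exact: mpre.
move=> C cC; rewrite setIC muleC.
apply: (@independent_of_cylinders (future n.+1)) => //; first by apply: mpre; exact: mcyl.
move=> D [B [mB [N BN] ->]]; case: cC => A [mA _ ->].
(* [past] repeats the coordinate [n], which therefore carries all the later
   constraints *)
pose A' j := if (j < n)%N then A j else \bigcap_(i in [set i | (n <= i)%N]) A i.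
have mA' j : measurable (A' j).
  by rewrite /A'; case: ifP => // _; apply: bigcap_measurable => //; exists n => /=.
pose C' j := if (j <= n)%N then A' j else B (j - n.+1)%N.
have mC' j : measurable (C' j) by rewrite /C'; case: ifP.
have pastE w : (past n @^-1` cylinder A) w <-> forall j, (j <= n)%N -> A' j (X j w).
  split=> /= [Aw j jn|Aw i].
    rewrite /A'; case: ltnP => [jn'|nj].
      by have := Aw j; rewrite /past (minn_idPl _)// ltnW.
    have {jn nj}-> : j = n by apply/eqP; rewrite eqn_leq jn.
    by move=> i /= ni; have := Aw i; rewrite /past (minn_idPr _).
  rewrite /past; case: (ltnP i n) => [iltn|ni].
    by have := Aw i (ltnW iltn); rewrite /A' iltn.
  by have := Aw n (leqnn n); rewrite /A' ltnn; apply.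
have futureE w : (future n.+1 @^-1` cylinder B) w <->
    forall j, (n < j < n.+1 + N)%N -> C' j (X j w).
  split=> /= [Bw j /andP[nj _]|Bw i].
    by have := Bw (j - n.+1)%N; rewrite /future subnKC// /C' leqNgt nj.
  case: (ltnP i N) => [iN|/BN->//].
  have := Bw (n.+1 + i)%N; rewrite /C' ltn_add2l iN leq_addr => /(_ isT).
  by rewrite leqNgt leq_addr/= addKn.
have -> : future n.+1 @^-1` cylinder B `&` past n @^-1` cylinder A =
    [set w | forall j, (j < n.+1 + N)%N -> C' j (X j w)].
  apply/seteqP; split=> w /=.
    move=> [/futureE Bw /pastE Aw] j jN; case: (leqP j n) => jn.
      by rewrite /C' jn; exact: Aw.
    by apply: Bw; rewrite jn.
  move=> Cw; split.
    by apply/futureE => j /andP[_ ?]; exact: Cw.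
  apply/pastE => j jn; have := Cw j; rewrite /C' jn; apply.
  exact: (leq_trans (n := n.+1) _ (leq_addr _ _)).
have -> : past n @^-1` cylinder A = [set w | forall j, (j < n.+1)%N -> A' j (X j w)].
  by apply/seteqP; split=> w /pastE.
rewrite (prob_future_cylinder _ mB BN) !prob_box//.
rewrite (big_cat_nat_idem _ (n := n.+1)) ?leq_addr//=; last by rewrite mule1.
rewrite muleC; congr (_ * _)%E.
  rewrite -{1}[n.+1]add0n big_addn addKn; apply: eq_bigr => i _.
  by rewrite /C' leqNgt ltn_addl//= addnK X_ident.
by apply: eq_big_nat => j /andP[_ jn]; rewrite /C' -ltnS jn.
Qed.

End iid_sequence.

(** * Almost sure behaviour *)

Section bullet_process_probability.
Context {R : realType} {d : measure_display} {T : measurableType d}.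
Variables (P : probability T R) (mu nu : probability (measurableTypeR R) R).
Variable X : nat -> {RV P >-> (measurableTypeR R * measurableTypeR R)%type}.
Hypothesis mu_pos : mu [set x : R | 0 < x] = 1%E.
Hypothesis nu_pos : nu [set x : R | 0 < x] = 1%E.
Hypothesis X_iid : iid_bullets X mu nu.
Let E := (measurableTypeR R * measurableTypeR R)%type.
Let S := sequences E.
Let b w : S := X^~ w.

Let X_indep : mutually_independent X := X_iid.1.

Let X_ident i A : measurable A -> P (X i @^-1` A) = P (X 0%N @^-1` A).
Proof.
move=> mA; have [_ h] := X_iid; rewrite -[LHS]/(distribution P (X i) A) !h//.
exact/esym/h.
Qed.

Let stat := stationary X_indep X_ident.
Let indep := past_future_independent X_indep X_ident.

Lemma ae_of_prob1 (A : set T) : measurable A -> P A = 1%E -> {ae P, forall w, A w}.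
Proof.
move=> mA PA; exists (~` A); split=> //; first exact: measurableC.
by rewrite probability_setC// PA subee.
Qed.

Lemma prob1_of_ae (A : set T) : measurable A -> {ae P, forall w, A w} -> P A = 1%E.
Proof.
move=> mA [N [mN N0 AN]]; have : P (~` A) = 0%E.
  apply/eqP; rewrite eq_le measure_ge0 andbT -N0.
  by apply: le_measure; rewrite ?inE//; exact: measurableC.
by move=> PA; rewrite -[A]setCK probability_setC ?PA ?sube0//; exact: measurableC.
Qed.

Let measurable_pre (U : {mfun T >-> S}) (F : set S) :
  measurable F -> measurable (U @^-1` F).
Proof.
move=> mF; rewrite -[X in measurable X]setTI.
exact: (measurable_funPT U measurableT).
Qed.

(** By stationarity an almost sure measurable property is almost surely shared
    by all the shifted sequences. *)
Lemma ae_future (F : set S) : measurable F -> {ae P, forall w, F (b w)} ->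
  {ae P, forall w, forall m, F (future X m w)}.
Proof.
move=> mF aeF; apply: ae_foralln => m; apply: ae_of_prob1; first exact: measurable_pre.
by rewrite stat//; apply: prob1_of_ae => //; exact: measurable_pre.
Qed.


Let mS i : measurable_fun setT (fun c : S => (c i).1 : R).
Proof. exact: measurable_velocity. Qed.

Let mD i : measurable_fun setT (fun c : S => (c i).2 : R).
Proof. exact: measurable_delay. Qed.

Let measurable_Xpre i (A : set E) : measurable A -> measurable (X i @^-1` A).
Proof.
move=> mA; rewrite -[X in measurable X]setTI.
exact: (measurable_funPT (X i) measurableT).
Qed.

Let mpos : measurable ([set x : R | 0 < x] : set (measurableTypeR R)).
Proof.
have : measurable [set x : R | 0 < x] by rewrite -set_itvoy; exact: measurable_itv.
by [].
Qed.

Lemma ae_bullet_in i (A B : set (measurableTypeR R)) : measurable A -> measurable B ->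
  mu A = 1%E -> nu B = 1%E -> {ae P, forall w, A (b w i).1 /\ B (b w i).2}.
Proof.
move=> mA mB muA nuB.
have mAB : measurable (A `*` B) by exact: measurableX.
apply: (@ae_of_prob1 (X i @^-1` (A `*` B))); first exact: measurable_Xpre.
rewrite -[LHS]/(distribution P (X i) _) X_iid.2// product_measure1E//.
transitivity (1 * 1 : \bar R)%E; last by rewrite mule1.
by congr (_ * _)%E; [exact: muA|exact: nuB].
Qed.

Lemma ae_positive : {ae P, forall w, forall i, 0 < (b w i).1 /\ 0 < (b w i).2}.
Proof. by apply: ae_foralln => i; exact: (ae_bullet_in i mpos mpos mu_pos nu_pos). Qed.

Lemma not_ae_False : ~ {ae P, forall w : T, False}.
Proof.
move=> [N [mN N0 TN]]; have : (P setT <= P N)%E.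
  by apply: le_measure; rewrite ?inE// => w _; exact: TN.
by rewrite probability_setT N0 lee_fin ler10.
Qed.

Let measurable_delay_gt (c : R) i : measurable [set s : S | c < (s i).2].
Proof.
under eq_set do rewrite -lte_fin.
apply: measurable_prop_lt; first exact: measurable_cst.
by apply/measurable_EFinP; exact: mD.
Qed.

Let prob_delay_gt (c : R) := P (past X 0 @^-1` [set s | c < (s 0%N).2]).

(** Otherwise the first delay would be almost surely at most 1/k for every
    k. *)
Lemma exists_delay_gt : exists2 c : R, 0 < c & (0 < prob_delay_gt c)%E.
Proof.
apply: contrapT => noc; apply: not_ae_False.
have null k : {ae P, forall w, ~ (k.+1%:R^-1 < (b w 0%N).2)}.
  exists (past X 0 @^-1` [set s | k.+1%:R^-1 < (s 0%N).2]); split.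
  - exact: measurable_pre.
  - have h : prob_delay_gt k.+1%:R^-1 = 0%E.
      apply/eqP; rewrite eq_le measure_ge0 andbT leNgt; apply/negP => pos.
      by apply: noc; exists k.+1%:R^-1.
    exact: h.
  - by move=> w /= /contrapT.
have all_null : {ae P, forall w, forall k : nat, ~ (k.+1%:R^-1 < (b w 0%N).2)}.
  exact: ae_foralln null.
near=> w.
have d0 : 0 < (b w 0%N).2.
  have : forall i, 0 < (b w i).1 /\ 0 < (b w i).2 by near: w; exact: ae_positive.
  by move=> /(_ 0%N)[].
have : forall k : nat, ~ (k.+1%:R^-1 < (b w 0%N).2) by near: w; exact: all_null.
have [k] := ltr_add_invr d0; rewrite add0r => h1 h2.
exact: (h2 k).
Unshelve. all: by end_near. Qed.

(** Let x be the probability that no delay exceeds [c] and p that of one delay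
    exceeding [c].  Splitting off the first delay gives x = (1 - p) x, so x = 0
    as p > 0. *)
Lemma ae_large_delays : exists2 dlt : R, 0 < dlt &
  {ae P, forall w, forall m, exists i, dlt < (b w (m + i)%N).2}.
Proof.
have [c c0 pc] := exists_delay_gt; exists c => //.
pose F0 := [set s : S | ~ c < (s 0%N).2].
pose F := [set s : S | forall i, ~ c < (s i).2].
have mF0 : measurable F0 by exact: measurable_not.
have mF : measurable F by apply: measurable_forall => i; exact: measurable_not.
have FE : future X 0 @^-1` F = past X 0 @^-1` F0 `&` future X 1 @^-1` F.
  apply/seteqP; split=> w /=.
    by move=> Fw; split; [exact: (Fw 0%N)|move=> i; exact: (Fw i.+1)].
  by move=> [F0w Fw] [|i]; [exact: F0w|exact: (Fw i)].
have F00 : P (future X 0 @^-1` F) = 0%E.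
  have := indep 0%N mF0 mF; rewrite -FE (stat 1%N mF).
  have -> : past X 0 @^-1` F0 = ~` (past X 0 @^-1` [set s | c < (s 0%N).2]) by [].
  rewrite probability_setC; last exact: measurable_pre.
  rewrite -/(prob_delay_gt c).
  have mP : measurable (future X 0 @^-1` F) by exact: measurable_pre.
  have mp : measurable (past X 0 @^-1` [set s | c < (s 0%N).2]) by exact: measurable_pre.
  move: pc; rewrite /prob_delay_gt -[P (future X 0 @^-1` F)]fineK ?fin_num_measure//.
  rewrite -[P (past X 0 @^-1` _)]fineK ?fin_num_measure//.
  set p := fine _; set x := fine _; rewrite lte_fin => p0.
  rewrite -EFinB -EFinM => -[xE]; congr EFin; apply/eqP.
  have : p * x == 0 by apply/eqP; move: xE; lra.
  by rewrite mulf_eq0 (gt_eqF p0).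
apply: ae_foralln => m; exists (future X m @^-1` F); split.
- exact: measurable_pre.
- have h : P (future X m @^-1` F) = 0%E by rewrite (stat m mF).
  exact: h.
- move=> w /= now i ci; apply: now; exists i.
  exact: ci.
Qed.

Lemma ae_regular : {ae P, forall w, regular (b w)}.
Proof.
have [dlt dlt0 large] := ae_large_delays.
near=> w.
have pos : forall i, 0 < (b w i).1 /\ 0 < (b w i).2 by near: w; exact: ae_positive.
apply: (regular_of_large_delays (fun i => (pos i).1) (fun i => (pos i).2) dlt0).
by near: w; exact: large.
Unshelve. all: by end_near. Qed.

Definition ghost_prob u := P (future X 0 @^-1` [set c | ghost_survives u c]).

Lemma thetaE u : theta X u = ghost_prob u.
Proof.
rewrite /theta /ghost_prob -(stat 1%N (measurable_ghost_survives u)); congr (P _).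
by apply/seteqP; split=> w;
  [move/survives_set_first_velocity|move=> ?; apply/survives_set_first_velocity].
Qed.

Lemma ae_ghost_perishes u : ~ (0 < theta X u)%E ->
  {ae P, forall w, forall m, ~ ghost_survives u (shift m (b w))}.
Proof.
rewrite thetaE => /negP; rewrite -leNgt => p0; apply: ae_foralln => m.
exists (future X m @^-1` [set c | ghost_survives u c]); split.
- by apply: measurable_pre; exact: measurable_ghost_survives.
- have h : P (future X m @^-1` [set c | ghost_survives u c]) = 0%E.
    rewrite (stat m (measurable_ghost_survives u)); apply/eqP; rewrite eq_le p0.
    exact: measure_ge0.
  exact: h.
- by move=> w /= /contrapT.
Qed.

Lemma measurable_faster u n :
  measurable [set c : S | potential_survivor c n /\ u < (c n).1].
Proof.
apply: measurable_conj; first exact: measurable_potential_survivor.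
under eq_set do rewrite -lte_fin.
apply: measurable_prop_lt; first exact: measurable_cst.
by apply/measurable_EFinP; exact: mS.
Qed.

(** The counting argument of the upper bound. *)
Lemma ae_finitely_many_faster0 u : 0 <= u -> (0 < theta X u)%E ->
  {ae P, forall w, exists N, forall n, (N <= n)%N ->
     ~ (potential_survivor (b w) n /\ u < (b w n).1)}.
Proof.
rewrite thetaE => u0 p0.
pose A n := past X n @^-1` [set c | potential_survivor c n /\ u < (c n).1].
pose B n := future X n.+1 @^-1` [set c | ghost_survives u c].
have AE n w : A n w <-> potential_survivor (b w) n /\ u < (b w n).1.
  rewrite /A /= {2}/past minnn; split=> -[pn un]; split=> //.
    by apply: eq_potential_survivor pn => i ilen; rewrite /past (minn_idPl ilen).
  by apply: eq_potential_survivor pn => i ilen; rewrite /past (minn_idPl ilen).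
have mA n : measurable (A n) by apply: measurable_pre; exact: measurable_faster.
have mB n : measurable (B n) by apply: measurable_pre; exact: measurable_ghost_survives.
have [N0 [mN0 PN0 N0regular]] := ae_regular.
pose D n := (A n `&` B n) `\` N0.
have mDD n : measurable (D n) by apply: measurableD => //; exact: measurableI.
have PD n : P (D n) = (ghost_prob u * P (A n))%E.
  have mAB : measurable (A n `&` B n) by exact: measurableI.
  have PAB : P (A n `&` B n) = (ghost_prob u * P (A n))%E.
    rewrite muleC /A /B indep//;
      [|exact: measurable_faster|exact: measurable_ghost_survives].
    by rewrite (stat n.+1 (measurable_ghost_survives u)).
  have null : P (A n `&` B n `&` N0) = 0%E.
    apply/eqP; rewrite eq_le measure_ge0 andbT -PN0.
    by apply: le_measure; rewrite ?inE//; exact: measurableI.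
  rewrite -PAB; transitivity (P (D n) + P (A n `&` B n `&` N0))%E.
    by rewrite null adde0.
  exact/esym/(measureDI P mAB mN0).
have trivD : trivIset setT D.
  have lt_absurd w i j : (i < j)%N -> D i w -> D j w -> False.
    move=> ij [[/AE[pi ui] Bi] nN] [[/AE[pj uj] Bj] _].
    have gw : regular (b w) by apply: contrapT => ngw; apply: nN; exact: N0regular.
    exact: (ghost_survives_unique gw u0 ij pi ui Bi pj uj Bj).
  move=> i j _ _ [w [Di Dj]]; case: (ltngtP i j) => // ij.
    by exfalso; exact: (lt_absurd w i j).
  by exfalso; exact: (lt_absurd w j i).
have sumD : (\sum_(0 <= n <oo) P (D n) <= 1)%E.
  rewrite -measure_semi_bigcup//; first exact/probability_le1/bigcupT_measurable.
  exact: bigcupT_measurable.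
have fin : (\sum_(n <oo) P (A n) < +oo)%E.
  have pfin : ghost_prob u = (fine (ghost_prob u))%:E.
    rewrite fineK// /ghost_prob fin_num_measure//.
    by apply: measurable_pre; exact: measurable_ghost_survives.
  rewrite ltey; apply/eqP => infA; move: sumD.
  under eq_eseriesr do rewrite PD pfin.
  rewrite nneseriesZl; last by move=> *; exact: measure_ge0.
  by rewrite infA -pfin gt0_muley.
have PA0 : P (lim_sup_set A) = 0%E by exact: lim_sup_set_cvg0.
exists (lim_sup_set A); split=> //.
  by apply: bigcapT_measurable => n; apply: bigcup_measurable.
move=> w /= noN n _; apply: contrapT => noj; apply: noN; exists n => j nj /AE Aj.
by apply: noj; exists j.
Qed.

(** Above the critical velocity it suffices to go down to a smaller velocity at
    which the survival probability is positive, so no monotonicity of [theta]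
    is involved. *)
Lemma ae_finitely_many_faster u :
  (critical_velocity X < u%:E)%E \/ (0 <= u /\ (0 < theta X u)%E) ->
  {ae P, forall w, forall m, exists N, forall n, (N <= n)%N ->
     potential_survivor (shift m (b w)) n -> (shift m (b w) n).1 <= u}.
Proof.
move=> hu; have [v vu [v0 pv]] : exists2 v, v <= u & 0 <= v /\ (0 < theta X v)%E.
  case: hu => [/ereal_inf_lt[_ [v [v0 pv] <-]]|[u0 pu]]; last by exists u.
  by rewrite lte_fin => vu; exists v => //; exact: ltW.
have aev := ae_finitely_many_faster0 v0 pv.
have mF : measurable [set c : S | exists N, forall n, (N <= n)%N ->
    ~ (potential_survivor c n /\ v < (c n).1)].
  apply: measurable_exists => N; apply: measurable_forall => n.
  by apply: measurable_if_prop => _; apply: measurable_not; exact: measurable_faster.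
have aeF := ae_future mF aev.
near=> w; move=> m.
have [N HN] : exists N, forall n, (N <= n)%N ->
    ~ (potential_survivor (shift m (b w)) n /\ v < (shift m (b w) n).1).
  by move: m; near: w; exact: aeF.
exists N => n Nn pn; apply: le_trans vu; rewrite leNgt; apply/negP => vn.
exact: (HN n Nn).
Unshelve. all: by end_near. Qed.

End bullet_process_probability.

(** * The critical velocity *)

Lemma ereal_rat_between (R : realType) (x y : \bar R) : (0 <= x)%E -> (x < y)%E ->
  exists q : rat, (x < (ratr q)%:E)%E /\ ((ratr q)%:E < y)%E.
Proof.
case: x => [r| |]//; last by move=> _; rewrite ltNge leey.
move=> _; case: y => [s| |]//.
- by rewrite lte_fin => /rat_in_itvoo[q]; rewrite in_itv/= => /andP[rq qs]; exists q.
- move=> _; have /rat_in_itvoo[q] : r < r + 1 by rewrite ltrDl.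
  by rewrite in_itv/= => /andP[rq _]; exists q; rewrite ltry.
Qed.

(** The deterministic conclusion; [viable u] stands for theta(u) > 0.  The two
    bounds are assumed at the rationals and at [vc] only.  A survivor b_l has
    velocity at least [vc]; if it is larger than [vc], a rational in between
    bounds the potential survivors behind b_l, and if it equals [vc] the bound
    at [vc] itself does. *)
Lemma vhat_eq (R : realType) (vc : \bar R) (viable : R -> Prop) (b : nat -> R * R) :
  regular b -> (0 <= vc)%E ->
  (forall u, 0 <= u -> (u%:E < vc)%E -> ~ viable u) ->
  (forall u, (exists q : rat, u = ratr q) \/ u = fine vc ->
     0 <= u -> ~ viable u -> forall m, ~ ghost_survives u (shift m b)) ->
  (forall u, (exists q : rat, u = ratr q) \/ u = fine vc ->
     (vc < u%:E)%E \/ (0 <= u /\ viable u) -> forall m, exists N, forall n, (N <= n)%N ->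
       potential_survivor (shift m b) n -> (shift m b n).1 <= u) ->
  vhat b = vc.
Proof.
move=> gb vc0 below perish few.
have slow l : ghost_survives (b l).1 (shift l.+1 b) ->
    exists N, forall n, (N <= n)%N -> potential_survivor (shift l.+1 b) n ->
      (shift l.+1 b n).1 <= (b l).1.
  move=> gl; have vl0 := regular_velocity gb l.
  have gsb := regular_shift l.+1 gb.
  case: (ltgtP vc (b l).1%:E) => [vcl|lvc|vcE].
  - have [q [q1 q2]] := ereal_rat_between vc0 vcl.
    have [|N HN] := few _ (or_introl (ex_intro _ q erefl)) _ l.+1; first by left.
    by exists N => n Nn pn; rewrite (le_trans (HN n Nn pn))// ltW// -lte_fin.
  - have [q [q1 q2]] := ereal_rat_between (ltW vl0 : (0 <= (b l).1%:E)%E) lvc.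
    have lq : (b l).1 <= ratr q by rewrite ltW// -lte_fin.
    have q0 : 0 <= ratr q :> R by rewrite (le_trans _ lq)// ltW.
    exfalso; apply: (perish _ (or_introl (ex_intro _ q erefl)) q0 (below _ q0 q2) l.+1).
    exact: ghost_survives_le (ltW vl0) lq gl.
  - have vE : (b l).1 = fine vc by rewrite vcE.
    case: (pselect (viable (b l).1)) => [g|ng].
      by apply: few; [right|right; split=> //; exact: ltW].
    by exfalso; apply: (perish (b l).1 _ _ ng l.+1) => //; [right|exact: ltW].
have faster u := @potential_survivors_faster R b u gb.
have io0 : forall N, exists n, [/\ (N <= n)%N, potential_survivor b n & 0 < (b n).1].
  by apply: faster => // m; exact/ghost0_perishes/regular_shift.
have infinitely_many N : exists2 n, (N <= n)%N & potential_survivor b n.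
  by have [n [Nn pn _]] := io0 N; exists n.
have vhat0 : (0 <= vhat b)%E by exact: (vhat_ge infinitely_many io0).
apply/eqP; rewrite eq_le; apply/andP; split; rewrite leNgt; apply/negP => lt_v.
- have [q [q1 q2]] := ereal_rat_between vc0 lt_v.
  have [|N HN] := few _ (or_introl (ex_intro _ q erefl)) _ 0%N; first by left.
  have := vhat_le infinitely_many (ex_intro _ N HN : exists N, forall n,
    (N <= n)%N -> potential_survivor b n -> (b n).1 <= ratr q).
  by rewrite leNgt q2.
- have [q [q1 q2]] := ereal_rat_between vhat0 lt_v.
  have q0 : 0 <= ratr q :> R by rewrite -lee_fin (le_trans vhat0)// ltW.
  have := vhat_ge infinitely_many (faster (ratr q) q0
    (perish _ (or_introl (ex_intro _ q erefl)) q0 (below _ q0 q2)) slow).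
  by rewrite leNgt q1.
Qed.

Theorem theorem2 (R : realType) (d : measure_display) (T : measurableType d)
    (P : probability T R) (mu nu : probability (measurableTypeR R) R)
    (X : nat -> {RV P >-> (measurableTypeR R * measurableTypeR R)%type})
    (mu_pos : mu [set x : R | 0 < x] = 1%E)
    (nu_pos : nu [set x : R | 0 < x] = 1%E)
    (X_iid : iid_bullets X mu nu)
    (X_valid : valid X) :
  \forall w \ae P, vhat (X^~ w) = critical_velocity X.
Proof.
set vc := critical_velocity X.
have vc0 : (0 <= vc)%E.
  by apply: le_ereal_inf_tmp => _ [v [v0 _] <-]; rewrite lee_fin.
pose viable u := (0 < theta X u)%E.
(* the countably many velocities at which the two bounds are used *)
pose dense (k : nat) : R := if k is k'.+1
  then if unpickle k' is Some q then ratr q else 0 else fine vc.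
have denseP u : (exists q : rat, u = ratr q) \/ u = fine vc -> exists k, u = dense k.
  by move=> [[q ->]|->]; [exists (pickle q).+1; rewrite /= pickleK|exists 0%N].
have regular_ae := ae_regular mu_pos nu_pos X_iid.
have perish_ae : {ae P, forall w, forall k, 0 <= dense k -> ~ viable (dense k) ->
    forall m, ~ ghost_survives (dense k) (shift m (X^~ w))}.
  apply: ae_foralln => k.
  case: (pselect (viable (dense k))) => [g|ng].
    by apply: filterE => w _ ng; exfalso; exact: ng.
  have := ae_ghost_perishes X_iid ng; apply: filterS => w H _ _; exact: H.
have few_ae : {ae P, forall w, forall k,
    (vc < (dense k)%:E)%E \/ (0 <= dense k /\ viable (dense k)) ->
    forall m, exists N, forall n, (N <= n)%N ->
       potential_survivor (shift m (X^~ w)) n -> (shift m (X^~ w) n).1 <= dense k}.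
  apply: ae_foralln => k.
  case: (pselect ((vc < (dense k)%:E)%E \/ (0 <= dense k /\ viable (dense k)))) => [h|nh].
    have := ae_finitely_many_faster mu_pos nu_pos X_iid h.
    by apply: filterS => w H _; exact: H.
  by apply: filterE => w h; exfalso; exact: nh.
near=> w.
apply: (@vhat_eq R vc viable) => //.
- by near: w; exact: regular_ae.
- move=> u u0 uvc g; move: uvc; rewrite ltNge => /negP; apply.
  by apply: ereal_inf_lbound; exists u.
- move=> u /denseP[k ->]; move: k; near: w; exact: perish_ae.
- move=> u /denseP[k ->]; move: k; near: w; exact: few_ae.
Unshelve. all: by end_near. Qed.
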